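(* Let $G=(V,E)$ be a 4-edge-connected 4-regular graph with an even number of vertices and with no proper 4-edge cut. Then the vector $(\frac32-\frac1{42})\cdot(\frac12\chi^{E})$ dominates (is coordinatewise at least) a convex combination of incidence vectors of tours of $G$.
   Context: A cut $U\subset V$ is proper if $|U|\ge2$ and $|V\setminus U|\ge2$; a proper 4-edge cut is a proper cut $U$ with $|\delta(U)|=4$, where $\delta(U)$ is the set of edges with exactly one endpoint in $U$. $\chi^E$ is the all-ones vector on $E$. A tour of $G$ is a connected, spanning, Eulerian multigraph on $V$ using only edges of $E$ (edges may be repeated); its incidence vector records edge multiplicities. *)

(* Defs.v *)
(* Graphs are finite loopless multigraphs: a finite vertex
   type V, a finite edge type E and an endpoint map ends : E -> V * V. *)
From HB Require Import structures.
From mathcomp Require Import all_boot all_order all_algebra.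
Set Implicit Arguments. Unset Strict Implicit. Unset Printing Implicit Defensive.
Import Order.TTheory GRing.Theory Num.Theory.

Section Graphs.
Variables (V E : finType) (ends : E -> V * V).

Definition loopless : Prop := forall e, (ends e).1 != (ends e).2.

Definition incident (v : V) (e : E) : bool := (v == (ends e).1) || (v == (ends e).2).

Definition delta (U : {set V}) : {set E} :=
  [set e | ((ends e).1 \in U) != ((ends e).2 \in U)].

Definition k_regular (k : nat) : Prop := forall v, #|[set e | incident v e]| = k.

Definition k_edge_connected (k : nat) : Prop :=
  forall U : {set V}, U != set0 -> U != setT -> k <= #|delta U|.

Definition proper_cut (U : {set V}) : bool := (2 <= #|U|) && (2 <= #|~: U|).

Definition no_proper_4_edge_cut : Prop :=
  forall U : {set V}, proper_cut U -> #|delta U| != 4.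

(* tours: multiplicity vectors m : E -> nat whose multigraph is spanning,
   connected and Eulerian (all degrees even) *)
Definition mult_adj (m : {ffun E -> nat}) : rel V :=
  fun x y => [exists e, (0 < m e) &&
     (((ends e).1 == x) && ((ends e).2 == y) || ((ends e).1 == y) && ((ends e).2 == x))].

Definition mult_deg (m : {ffun E -> nat}) (v : V) : nat :=
  \sum_(e | incident v e) m e.

Definition is_tour (m : {ffun E -> nat}) : Prop :=
  (forall x y : V, connect (mult_adj m) x y) /\ (forall v, ~~ odd (mult_deg m v)).

End Graphs.

(* Main.v *)
(* The tours come from costs: by linear programming duality it suffices to find, for every cost
   c : E -> nat, a tour of cost at most 31/42 c(E).

   Since G is 4-regular and 4-edge-connected, the vector 1/4 is in the perfect matching polytope,
   so some perfect matching M has c(M) <= c(E)/4.  As {u,v} has a cut of exactly six edges for uv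
   in M, contracting M gives a 6-regular graph; a proper 7-colouring of it yields S in M with
   c(S) >= c(M)/7 whose edges are pairwise non-adjacent in G/M.  The vector 1 on M, 1/3 off M has
   value 2 on every star and at least 2 on every other cut, so it gives spanning trees, and matroid
   intersection allows us to demand moreover that the tree contains S and exactly one further edge at
   each end of S.  These ends then have even degree, so the parity of the tree is corrected
   fractionally by 1/2 on M minus S and 1/6 elsewhere (baseline: 1/2 on all of M): stars of odd
   vertices still have value 1, and the other cuts have at least six edges.  The total is
   3/2 c(M) + 1/2 c(E - M) - 1/3 c(S) <= (3/4 - 1/84) c(E). *)
Require Import Defs.
From HB Require Import structures.
From mathcomp Require Import all_boot all_order all_algebra.
From mathcomp Require Import zify lra.
From Stdlib Require Import Classical.
Set Implicit Arguments. Unset Strict Implicit. Unset Printing Implicit Defensive.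
Import Order.TTheory GRing.Theory Num.Theory.
Local Open Scope ring_scope.

(** * Minimum-cost T-joins (after Sebo) *)

(** Edge sets are vectors over the two-element field, realised by [bool], so symmetric difference is
    [+]. [J] is a T-join exactly when [boundary J = T]; a loop contributes nothing. *)
Definition boundary (V E : finType) (ends : E -> V * V) (J : {ffun E -> bool}) :
    {ffun V -> bool} :=
  [ffun v => \sum_e J e * ((v == (ends e).1) (+) (v == (ends e).2))].
Definition vtx (V : finType) (v : V) : {ffun V -> bool} := [ffun x => x == v].
Definition edg (E : finType) (e : E) : {ffun E -> bool} := [ffun x => x == e].
Definition cost (E : finType) (c : E -> nat) (J : {ffun E -> bool}) : nat :=
  (\sum_(e | J e) c e)%N.

Ltac f2_cancel :=
  repeat match goal with |- context [boundary ?ends ?J] => generalize (boundary ends J) end;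
  intros; let x := fresh "x" in
  apply/ffunP => x; rewrite !ffunE;
  repeat match goal with
  | |- context [@fun_of_fin _ _ _ ?f x] => case: (f x)
  | |- context [x == ?y] => case: (x == y)
  end; by [].

Section Joins.
Variables (V E : finType) (ends : E -> V * V).
Implicit Types (J K P Q Y : {ffun E -> bool}) (c : E -> nat) (U : {set V}).
Local Notation boundary := (boundary ends).

Lemma boundaryD J K : boundary (J + K) = boundary J + boundary K.
Proof.
apply/ffunP => v; rewrite !ffunE -big_split /=.
by apply: eq_bigr => e _; rewrite ffunE mulrDl.
Qed.

Lemma boundary_edg e : boundary (edg e) = vtx (ends e).1 + vtx (ends e).2.
Proof.
apply/ffunP => v; rewrite !ffunE (bigD1 e) //= big1 ?addr0 => [|f /negPf fe].
  by rewrite ffunE eqxx mul1r.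
by rewrite ffunE fe mul0r.
Qed.

Lemma sum_boundary J (p : V -> bool) :
  \sum_v boundary J v * p v = \sum_e J e * (p (ends e).1 (+) p (ends e).2).
Proof.
under eq_bigr => v _ do rewrite ffunE mulr_suml.
rewrite exchange_big /=; apply: eq_bigr => e _.
under eq_bigr => v _ do rewrite -mulrA.
rewrite -mulr_sumr; congr (_ * _).
rewrite -[RHS]/(p (ends e).1 + p (ends e).2).
under eq_bigr => v _ do rewrite -[_ (+) _]/((v == (ends e).1) + (v == (ends e).2)) mulrDl.
rewrite big_split /=; congr (_ + _).
  rewrite (bigD1 (ends e).1) //= eqxx mul1r big1 ?addr0 // => v /negPf->.
  by rewrite mul0r.
rewrite (bigD1 (ends e).2) //= eqxx mul1r big1 ?addr0 // => v /negPf->.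
by rewrite mul0r.
Qed.

Lemma sum_bool_odd (I : finType) (P Q : pred I) :
  \sum_(i | P i) Q i = odd #|[set i | P i && Q i]| :> bool.
Proof.
rewrite -sum1_card; under [in RHS]eq_bigl => i do rewrite inE.
rewrite big_mkcondr (big_morph odd oddD (erefl : odd 0 = false)) /=.
by apply: eq_bigr => i _; case: (Q i).
Qed.

Lemma sum_boundary_in J U :
  \sum_(v in U) boundary J v = odd #|[set e in delta ends U | J e]|.
Proof.
rewrite -sum_bool_odd big_mkcond /=.
transitivity (\sum_v boundary J v * (v \in U)).
  by apply: eq_bigr => v _; case: (v \in U); rewrite ?mulr1 ?mulr0.
rewrite sum_boundary [RHS]big_mkcond; apply: eq_bigr => e _.
by rewrite inE; case: (_ \in U); case: (_ \in U); rewrite ?mulr1 ?mulr0.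
Qed.

(** The boundary is adjoint to the coboundary of [p]. Hence joins with equal boundary have costs of
    equal parity, which the exchange step relies on. *)
Lemma odd_cost c J (p : V -> bool) :
  (forall e, odd (c e) = p (ends e).1 (+) p (ends e).2) ->
  odd (cost c J) = \sum_v boundary J v * p v.
Proof.
move=> cp; rewrite sum_boundary /cost (big_morph odd oddD (erefl : odd 0 = false)).
by rewrite big_mkcond; apply: eq_bigr => e _; rewrite cp; case: (J e).
Qed.

Lemma sum_vtx (p : V -> bool) v : \sum_x vtx v x * p x = p v.
Proof.
rewrite (bigD1 v) //= ffunE eqxx mul1r big1 ?addr0 // => x /negPf xv.
by rewrite ffunE xv mul0r.
Qed.

Lemma cost_edg c J e : J e -> cost c (J + edg e) = (cost c J - c e)%N.
Proof.
move=> Je; rewrite /cost [in RHS](bigD1 e) //= addKn; apply: eq_bigl => f.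
by rewrite !ffunE; case: eqP => [->|_]; rewrite ?Je //=; case: (J f).
Qed.

Lemma cost_edgN c J e : ~~ J e -> cost c (J + edg e) = (cost c J + c e)%N.
Proof.
move=> Je; rewrite /cost [in LHS](bigD1 e) /=; last by rewrite !ffunE eqxx (negPf Je).
rewrite addnC; congr addn; apply: eq_bigl => f.
by rewrite !ffunE; case: eqP => [->|_]; rewrite ?(negPf Je) //=; case: (J f).
Qed.

Lemma cost_ge c J e : J e -> (c e <= cost c J)%N.
Proof. by move=> Je; rewrite /cost (bigD1 e) //= leq_addr. Qed.

Lemma cost_leD c J K : (cost c (J + K)%R <= cost c J + cost c K)%N.
Proof.
rewrite /cost !(big_mkcond (fun e => fun_of_fin _ e)) -big_split /=.
by apply: leq_sum => e _; rewrite ffunE; case: (J e); case: (K e) => //=; rewrite leq_addr.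
Qed.

Lemma costD0 c J K : cost c K = 0%N -> cost c (J + K) = cost c J.
Proof.
move=> K0; apply/eqP; rewrite eqn_leq.
have := cost_leD c J K; rewrite K0 addn0 => -> /=.
have := cost_leD c (J + K) K; rewrite K0 addn0.
by have -> : J + K + K = J by f2_cancel.
Qed.

(* Phrased with joins rather than paths: a component of Q is closed under toggling edges. *)
Definition reach (Q : {ffun E -> bool}) (x : V) : {set V} :=
  [set y | [exists P, (boundary P == vtx x + vtx y) && [forall e, P e ==> Q e]]].

Lemma reachP Q x y :
  reflect (exists2 P, boundary P = vtx x + vtx y & forall e, P e -> Q e)
          (y \in reach Q x).
Proof.
rewrite inE; apply: (iffP existsP) => [[P /andP[/eqP h /forallP PQ]]|[P h PQ]].
  by exists P => // e; move/(_ e): PQ => /implyP.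
by exists P; rewrite h eqxx; apply/forallP => e; apply/implyP/PQ.
Qed.

Lemma boundary0 : boundary 0 = 0.
Proof. by have := boundaryD 0 0; rewrite addr0 -{1}[boundary 0]addr0 => /addrI. Qed.

Lemma reach_refl Q x : x \in reach Q x.
Proof.
apply/reachP; exists 0 => [|e]; last by rewrite ffunE.
by rewrite boundary0; f2_cancel.
Qed.

Lemma reach_sym Q x y : (x \in reach Q y) = (y \in reach Q x).
Proof. by apply/reachP/reachP => -[P h PQ]; exists P; rewrite // h addrC. Qed.

Lemma reach_trans Q x y z : y \in reach Q x -> z \in reach Q y -> z \in reach Q x.
Proof.
move=> /reachP[P hP PQ] /reachP[P' hP' PQ']; apply/reachP; exists (P + P').
  by rewrite boundaryD hP hP'; f2_cancel.
by move=> e; rewrite ffunE; case Pe: (P e); case Pe': (P' e) => // _; [exact: PQ|exact: PQ'].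
Qed.

Lemma reach_edge Q x e : Q e -> ((ends e).1 \in reach Q x) = ((ends e).2 \in reach Q x).
Proof.
move=> Qe.
have h : (ends e).2 \in reach Q (ends e).1.
  by apply/reachP; exists (edg e); rewrite ?boundary_edg // => f; rewrite ffunE => /eqP->.
by apply/idP/idP => /reach_trans; apply; rewrite // reach_sym.
Qed.

Lemma in_delta e U : (e \in delta ends U) = (((ends e).1 \in U) != ((ends e).2 \in U)).
Proof. by rewrite inE. Qed.

Lemma in_delta_sep e U (X : pred E) :
  (e \in [set f in delta ends U | X f]) = (e \in delta ends U) && X e.
Proof. by rewrite inE. Qed.

(* F is cheapest among the joins of T + a + b for all pairs a, b, including a = b. *)
Section MinJoin.
Variables (T : {ffun V -> bool}) (c : E -> nat) (p : V -> bool).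
Hypothesis c_parity : forall e, odd (c e) = p (ends e).1 (+) p (ends e).2.
Variables (a b : V) (F : {ffun E -> bool}).
Hypothesis bdF : boundary F = T + vtx a + vtx b.
Hypothesis Fmin : forall J a' b', boundary J = T + vtx a' + vtx b' ->
  (cost c F <= cost c J)%N.

Let Z : {ffun E -> bool} := [ffun e => c e == 0%N].
Let B := reach Z b.

Lemma cost_zero_edges P : (forall e, P e -> Z e) -> cost c P = 0%N.
Proof. by move=> PZ; apply: big1 => e /PZ; rewrite ffunE => /eqP. Qed.

(** Adding a zero-cost path from [b] to [b'] turns [J] into a join of [T + a + x] of the same cost,
    a competitor of [F]. *)
Lemma min_from_B b' x J : b' \in B -> boundary J = boundary F + vtx b' + vtx x ->
  (cost c F <= cost c J)%N.
Proof.
move=> /reachP[P bP PZ] bJ; rewrite -(costD0 J (cost_zero_edges PZ)).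
apply: (Fmin (a' := a) (b' := x)); rewrite boundaryD bJ bP bdF; f2_cancel.
Qed.

Lemma zero_edge_B e : c e = 0%N -> ((ends e).1 \in B) = ((ends e).2 \in B).
Proof. by move=> ce; apply: reach_edge; rewrite ffunE ce. Qed.

Lemma delta_B_gt0 e : e \in delta ends B -> (0 < c e)%N.
Proof. by rewrite inE lt0n; apply: contraNN => /eqP/zero_edge_B->. Qed.

(** Dropping such an edge from [F] would move an end of [F] from [B] to the other endpoint and save
    the positive cost of the edge. *)
Lemma F_delta_B e : e \in delta ends B -> ~~ F e.
Proof.
move=> eB; apply/negP => Fe; have ce := delta_B_gt0 eB.
have bFe : boundary (F + edg e) = boundary F + vtx (ends e).1 + vtx (ends e).2.
  by rewrite boundaryD boundary_edg addrA.
have cFe := cost_edg c Fe; have := cost_ge c Fe.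
suff : (cost c F <= cost c (F + edg e)%R)%N by lia.
move: eB; rewrite inE; case b1: ((ends e).1 \in B); case b2: ((ends e).2 \in B) => // _.
  exact: min_from_B b1 bFe.
by apply: (min_from_B b2 (x := (ends e).1)); rewrite bFe; f2_cancel.
Qed.

(* The exchange step: two edges of J in delta(B) are traded, together with a path of J + F
   outside B, for the complementary path; minimality of F makes this gain at least 2. *)
Lemma exchange J i j (x y : E -> V) : boundary J = T ->
  (forall e, e \in delta ends B -> x e \in B) ->
  (forall e, e \in delta ends B -> boundary (edg e) = vtx (x e) + vtx (y e)) ->
  i \in delta ends B -> j \in delta ends B -> i != j -> J i -> J j ->
  y j \in reach [ffun e => [&& (J + F) e, (ends e).1 \notin B & (ends e).2 \notin B]] (y i) ->
  exists J', [/\ boundary J' = T, (cost c J' + 2 <= cost c J)%N &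
    #|[set e in delta ends B | J' e]|.+2 = #|[set e in delta ends B | J e]|].
Proof.
move=> bJ xB bxy iB jB ij Ji Jj /reachP[P bP PQ].
have Pout e : P e -> e \notin delta ends B.
  by move=> /PQ; rewrite ffunE => /and3P[_ /negPf e1 /negPf e2]; rewrite inE e1 e2.
have Pi : ~~ P i by apply/negP => /Pout; rewrite iB.
have Pj : ~~ P j by apply/negP => /Pout; rewrite jB.
(* [Y] links the two inner endpoints at zero cost, so that [C + Y] is closed. *)
have [Y bY YZ] : exists2 Y, boundary Y = vtx (x i) + vtx (x j) & forall e, Y e -> Z e.
  by apply/reachP; apply: reach_trans (xB _ jB); rewrite reach_sym xB.
have Y0 := cost_zero_edges YZ.
have YB e : e \in delta ends B -> Y e = false.
  by move=> /delta_B_gt0 ce; apply/negP => /YZ; rewrite ffunE; case: (c e) ce.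
pose C := P + edg i + edg j.
have bC : boundary C = vtx (x i) + vtx (x j).
  by rewrite !boundaryD bP (bxy _ iB) (bxy _ jB); f2_cancel.
have CQ e : C e -> F e = ~~ J e.
  rewrite !ffunE; case: eqP => [->|_]; first by rewrite Ji (negPf (F_delta_B iB)).
  case: eqP => [->|_]; first by rewrite Jj (negPf (F_delta_B jB)).
  case Pe: (P e) => // _; have := PQ _ Pe; rewrite !ffunE => /and3P[+ _ _].
  by case: (J e); case: (F e).
(* On [C] the sets [J] and [F] are complementary, so toggling [C] in both preserves the total
   cost. *)
have bal : (cost c J + cost c F = cost c (J + C)%R + cost c (F + C)%R)%N.
  rewrite /cost !(big_mkcond (fun e => fun_of_fin _ e)) -!big_split /=.
  apply: eq_bigr => e _; rewrite ![fun_of_fin (_ + C) e]ffunE.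
  by have := CQ e; case: (C e) => [/(_ isT)->|_]; case: (J e); rewrite //= ?addr0 ?addn0.
have FC1 : cost c (F + C) = (cost c (F + P + edg j)%R + c i)%N.
  rewrite -cost_edgN; first by congr cost; rewrite /C; f2_cancel.
  by rewrite !ffunE (negPf (F_delta_B iB)) (negPf Pi) (negPf ij).
have FC2 : (cost c F <= cost c (F + P + edg j)%R)%N.
  apply: (min_from_B (xB _ jB) (x := y i)).
  by rewrite !boundaryD bP (bxy _ jB); f2_cancel.
have ci := delta_B_gt0 iB.
have CE e : C e = P e + (e == i) + (e == j) by rewrite !ffunE.
clearbody C.
(* [FC1] and [FC2] make [F + C] strictly dearer than [F]. With equal parities the surplus is at
   least 2, and [bal] turns it into a saving for [J]. *)
have FCodd : odd (cost c (F + C)) = odd (cost c F).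
  have -> : cost c (F + C) = cost c (F + C + Y) by rewrite (costD0 _ Y0).
  rewrite !(odd_cost _ c_parity); have -> // : boundary (F + C + Y) = boundary F.
  by rewrite !boundaryD bC bY; f2_cancel.
exists (J + C + Y); split.
- by rewrite !boundaryD bJ bC bY; f2_cancel.
- rewrite (costD0 _ Y0); have := odd_double_half (cost c (F + C)).
  have := odd_double_half (cost c F); move: FCodd FC1 FC2 bal ci.
  by move=> -> *; lia.
have mem (X : {ffun E -> bool}) e :
  (e \in [set e in delta ends B | X e]) = (e \in delta ends B) && X e by rewrite in_set.
have ji : j != i by rewrite eq_sym.
rewrite (cardsD1 i [set e in _ | J e]) (cardsD1 j (_ :\ i)) in_setD1 !mem ji iB jB Ji Jj.
rewrite /= !add1n; congr (_.+2); apply: eq_card => e; rewrite !in_setD1 !mem.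
case eB: (e \in delta ends B); last by rewrite !andbF.
rewrite !ffunE (YB _ eB) CE; have -> : P e = false by apply/negP => /Pout; rewrite eB.
case: (eqVneq e j) => [->|ej]; first by rewrite Jj (negPf ji).
by case: (eqVneq e i) => [->|ei]; rewrite ?Ji //=; case: (J e).
Qed.

(** The set [J + F] has boundary a + b. A component of it outside [B] that avoids [a] receives an
    even number of the [J]-edges leaving [B]. So either one of the two given edges has a partner in
    its component, or both lead to the component of [a]; [exchange] applies in each case. *)
Lemma exchange_exists J : boundary J = T -> a \notin B ->
  (1 < #|[set e in delta ends B | J e]|)%N ->
  exists J', [/\ boundary J' = T, (cost c J' + 2 <= cost c J)%N &
    #|[set e in delta ends B | J' e]|.+2 = #|[set e in delta ends B | J e]|].
Proof.
move=> bJ aB /card_gt1P[i1 [i2 [+ + i12]]].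
rewrite !in_delta_sep => /andP[i1B Ji1] /andP[i2B Ji2].
pose x e := if (ends e).1 \in B then (ends e).1 else (ends e).2.
pose y e := if (ends e).1 \in B then (ends e).2 else (ends e).1.
have xB e : e \in delta ends B -> x e \in B.
  by rewrite in_delta /x; case: ((ends e).1 \in B) / boolP => //; case: ((ends e).2 \in B).
have yB e : e \in delta ends B -> y e \notin B.
  by rewrite in_delta /y; case: ((ends e).1 \in B) / boolP => //; case: ((ends e).2 \in B).
have bxy e : boundary (edg e) = vtx (x e) + vtx (y e).
  by rewrite boundary_edg /x /y; case: ifP => // _; rewrite addrC.
pose Q := [ffun e => [&& (J + F) e, (ends e).1 \notin B & (ends e).2 \notin B]].
suff [i [j [iB jB Ji Jj [ij yji]]]] : exists i j,
    [/\ i \in delta ends B, j \in delta ends B, J i, J j & i != j /\ y j \in reach Q (y i)].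
  by apply: (exchange (i := i) (j := j) (x := x) (y := y)).
have Rout i v : i \in delta ends B -> v \in reach Q (y i) -> v \notin B.
  move=> iB /reachP[P bP PQ]; apply/negP => vB.
  have : boundary P v = 0.
    rewrite ffunE big1 // => e _; case Pe: (P e); last by rewrite mul0r.
    have := PQ _ Pe; rewrite ffunE => /and3P[_ e1 e2].
    by rewrite (negPf (memPn e1 v vB)) (negPf (memPn e2 v vB)) mulr0.
  by rewrite bP !ffunE eqxx (negPf (memPn (yB _ iB) v vB)).
(* Edges of [J + F] leaving the component all go to [B], where [F] has none. So the boundary a + b,
   summed over the component, counts the [J]-edges coming from [B]. *)
have Rodd i : i \in delta ends B ->
    odd #|[set e in delta ends B | J e && (y e \in reach Q (y i))]| = (a \in reach Q (y i)).
  move=> iB; set R := reach Q (y i).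
  have bR : b \notin R by apply/negP => /(Rout _ _ iB); rewrite reach_refl.
  have : \sum_(v in R) boundary (J + F) v = (a \in R).
    have -> : boundary (J + F) = vtx a + vtx b by rewrite boundaryD bJ bdF; f2_cancel.
    rewrite big_mkcond /=; transitivity (\sum_v vtx a v * (v \in R) + \sum_v vtx b v * (v \in R)).
      rewrite -big_split; apply: eq_bigr => v _; rewrite ffunE /=.
      by case: (v \in R); rewrite ?mulr1 ?mulr0.
    by rewrite !sum_vtx (negPf bR) addr0.
  rewrite sum_boundary_in => <-; congr odd; apply: eq_card => e; rewrite !in_delta_sep !in_delta [(J + F) e]ffunE.
  have R1 : (ends e).1 \in R -> (ends e).1 \notin B by apply: Rout.
  have R2 : (ends e).2 \in R -> (ends e).2 \notin B by apply: Rout.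
  have Fe := F_delta_B (e := e); rewrite in_delta in Fe.
  have := reach_edge (y i) (Q := Q) (e := e); rewrite -/R [Q e]ffunE [(J + F) e]ffunE /y.
  move: R1 R2 Fe; case: ((ends e).1 \in B); case: ((ends e).2 \in B);
    case: ((ends e).1 \in R); case: ((ends e).2 \in R); case: (J e); case: (F e);
    move=> h1 h2 h3 h4;
    by [|have := h1 isT|have := h2 isT|have := h3 isT|have := h4 isT].
have key i : i \in delta ends B -> J i -> a \notin reach Q (y i) ->
    exists2 j, j \in delta ends B & [&& J j, i != j & y j \in reach Q (y i)].
  move=> iB Ji aR; have := Rodd i iB; rewrite (negPf aR).
  rewrite (cardsD1 i) in_delta_sep iB Ji reach_refl oddD /= => /negbFE odd1.
  have /card_gt0P[j] : (0 < #|[set e in delta ends B | J e && (y e \in reach Q (y i))] :\ i|)%N.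
    by case: #|_| odd1.
  by rewrite in_setD1 in_delta_sep => /and4P[ji jB Jj jR]; exists j; rewrite // Jj eq_sym ji.
case a1: (a \in reach Q (y i1)); last first.
  by have [j jB /and3P[Jj ij jR]] := key i1 i1B Ji1 (negbT a1); exists i1, j.
case a2: (a \in reach Q (y i2)); last first.
  by have [j jB /and3P[Jj ij jR]] := key i2 i2B Ji2 (negbT a2); exists i2, j.
by exists i1, i2; split=> //; split=> //; apply: reach_trans a1 _; rewrite reach_sym.
Qed.

End MinJoin.

Definition odd_in (T : {ffun V -> bool}) U : bool := \sum_(v in U) T v.

Lemma odd_in_sum T U : odd_in T U = \sum_v T v * (v \in U).
Proof.
by rewrite /odd_in big_mkcond; apply: eq_bigr => v _; case: (v \in U); rewrite ?mulr1 ?mulr0.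
Qed.

Lemma odd_inD T T' U : odd_in (T + T') U = odd_in T U + odd_in T' U.
Proof. by rewrite /odd_in -big_split; apply: eq_bigr => v _; rewrite ffunE. Qed.

Lemma odd_in_vtx v U : odd_in (vtx v) U = (v \in U).
Proof. by rewrite odd_in_sum sum_vtx. Qed.

(* The parity hypothesis says that every closed walk has even cost. *)
Lemma min_join_parity (T : {ffun V -> bool}) (w : E -> nat) (q : nat) (c : E -> nat)
    (p : V -> bool) :
  (forall e, odd (c e) = p (ends e).1 (+) p (ends e).2) ->
  (forall U, odd_in T U -> (q <= \sum_(e in delta ends U) w e)%N) ->
  (exists J, boundary J = T) ->
  exists2 J, boundary J = T & (q * cost c J <= \sum_e w e * c e)%N.
Proof.
move=> + qcut exT; have [N cN] := ubnP (\sum_e c e); elim: N => // N IH in c p cN *.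
move=> c_parity; have [J0 bJ0] := exT.
have [->|q_gt0] := posnP q; first by exists J0.
have [J [bJ Jmin]] : exists J, boundary J = T /\
    forall K, boundary K = T -> (cost c J <= cost c K)%N.
  have [J /eqP bJ Jmin] := arg_minnP (cost c) (introT eqP bJ0 : [pred J | boundary J == T] J0).
  by exists J; split=> // K /eqP; apply: Jmin.
exists J => //; have [->|cJ] := posnP (cost c J); first by rewrite muln0.
(* These are the candidates for the set [F] of the exchange argument; deleting from [J] an edge of
   positive cost gives one cheaper than [J]. *)
pose near_T K := [exists a, exists b, boundary K == T + vtx a + vtx b].
have near_intro K a b : boundary K = T + vtx a + vtx b -> near_T K.
  by move=> bK; apply/existsP; exists a; apply/existsP; exists b; apply/eqP.
have [e Je ce] : exists2 e, J e & (0 < c e)%N.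
  have := cJ; rewrite lt0n sum_nat_eq0 => /forallPn[e]; rewrite negb_imply -lt0n.
  by case/andP; exists e.
have bJe : boundary (J + edg e) = T + vtx (ends e).1 + vtx (ends e).2.
  by rewrite boundaryD bJ boundary_edg addrA.
have [F Fnear Fle] := arg_minnP (cost c) (near_intro _ _ _ bJe).
have cFJ : (cost c F < cost c J)%N.
  have := Fle _ (near_intro _ _ _ bJe); rewrite (cost_edg c Je).
  by have := cost_ge c Je; lia.
have /existsP[a /existsP[b /eqP bF]] := Fnear.
have Fmin K a' b' : boundary K = T + vtx a' + vtx b' -> (cost c F <= cost c K)%N.
  by move/near_intro; apply: Fle.
pose B := reach [ffun e => c e == 0%N] b.
(* Otherwise a zero-cost path between [a] and [b] would complete [F] to a T-join cheaper than
   [J]. *)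
have aB : a \notin B.
  apply/negP => /reachP[P bP PZ].
  have := Jmin (F + P); rewrite boundaryD bF bP => H.
  have : (cost c J <= cost c (F + P)%R)%N by apply: H; f2_cancel.
  by rewrite (costD0 _ (cost_zero_edges PZ)) leqNgt cFJ.
have B_gt0 f : f \in delta ends B -> (0 < c f)%N by apply: delta_B_gt0.
(* [F] avoids the cut of [B], and of the two extra vertices in its boundary only [b] lies in [B]. *)
have TB : odd_in T B.
  have : odd_in (boundary F) B = false.
    rewrite /odd_in sum_boundary_in eq_card0 // => f; rewrite in_delta_sep.
    by apply/andP => -[fB]; apply/negP; apply: (F_delta_B bF Fmin).
  rewrite bF !odd_inD !odd_in_vtx reach_refl (negPf aB) addr0.
  by case: (odd_in T B).
(* Lowering the cost by one on the cut of the T-odd set [B] lowers the right-hand side by at least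
   [q]. Adding the indicator of [B] to the potential keeps the parity condition. *)
pose c' e := (c e - (e \in delta ends B))%N.
have c'E f : c f = (c' f + (f \in delta ends B))%N.
  by rewrite /c'; have := B_gt0 f; case: (f \in delta ends B) => [/(_ isT)|_]; lia.
have sumB (h : E -> nat) :
    (\sum_e h e * c e = \sum_e h e * c' e + \sum_(e in delta ends B) h e)%N.
  rewrite [X in (_ + X)%N]big_mkcond -big_split; apply: eq_bigr => f _ /=.
  by rewrite c'E mulnDr; case: (f \in delta ends B); rewrite ?muln1 ?muln0.
have dB : (0 < #|delta ends B|)%N.
  rewrite lt0n; apply/eqP => /cards0_eq B0.
  by have := qcut B TB; rewrite B0 big_set0; lia.
have [||K bK cK] := IH c' (fun v => p v (+) (v \in B)).
- suff : (\sum_e c e = \sum_e c' e + #|delta ends B|)%N by move: cN dB; lia.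
  rewrite -sum1_card [X in (_ + X)%N]big_mkcond -big_split.
  by apply: eq_bigr => f _; rewrite /= c'E; case: (f \in _).
- move=> f; have := c_parity f; rewrite (c'E f) oddD in_delta.
  by do 2![case: (p _)]; do 2![case: (_ \in B)]; case: (odd _).
(* The minimum drops by at most one: an exchange removes two cut edges and at least 2 of cost, so by
   induction a T-join with k edges in the cut costs at least c(J) + k - 1. *)
have cKJ : (cost c J <= cost c' K + 1)%N.
  suff H n (X : {ffun E -> bool}) : (#|[set e in delta ends B | X e]| < n)%N -> boundary X = T ->
      (cost c J + #|[set e in delta ends B | X e]| <= cost c X + 1)%N.
    have := H _ K (ltnSn _) bK; suff -> : cost c K = (cost c' K + #|[set e in delta ends B | K e]|)%N by lia.
    rewrite /cost -sum1_card [X in (_ + X)%N]big_mkcond [LHS]big_mkcond [X in (X + _)%N]big_mkcond -big_split /=.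
    by apply: eq_bigr => f _; rewrite in_delta_sep (c'E f); case: (K f); case: (_ \in _).
  elim: n X => // n IHn X Xn bX.
  have [k1|k2] := leqP #|[set e in delta ends B | X e]| 1; first by have := Jmin _ bX; lia.
  have [X' [bX' cX' kX']] := exchange_exists c_parity bF Fmin bX aB k2.
  by have := IHn X' _ bX'; rewrite -/B in kX' *; lia.
rewrite sumB; apply: leq_trans (leq_add cK (qcut B TB)).
by rewrite -mulnSr leq_pmul2l // -addn1.
Qed.

(** Integrality of the T-join polyhedron: [w] divided by [q] covers every T-odd cut. Doubled costs
    satisfy the parity condition with zero potential, and the factor 2 cancels. *)
Theorem min_join_le (T : {ffun V -> bool}) (w : E -> nat) (q : nat) (c : E -> nat) :
  (forall U, odd_in T U -> (q <= \sum_(e in delta ends U) w e)%N) ->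
  (exists J, boundary J = T) ->
  exists2 J, boundary J = T & (q * cost c J <= \sum_e w e * c e)%N.
Proof.
move=> qcut exT.
have [|J bJ] := min_join_parity (c := fun e => (c e).*2) (p := fun=> false) _ qcut exT.
  by move=> e; rewrite odd_double.
have -> : (cost (fun e => (c e).*2) J = (cost c J).*2)%N.
  by rewrite /cost (big_morph double doubleD (erefl : 0.*2 = 0)%N).
under eq_bigr do rewrite -doubleMr.
rewrite -(big_morph double doubleD (erefl : 0.*2 = 0)%N) -doubleMr leq_double.
by exists J.
Qed.

End Joins.

(** * Farkas' lemma *)

Section Farkas.
Variables (R : realFieldType) (D : finType).
Implicit Types (x y g : D -> R).

Definition dot x y : R := \sum_d x d * y d.

Lemma dotBZl a x y z : dot (fun d => x d - a * y d) z = dot x z - a * dot y z.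
Proof. by rewrite /dot mulr_sumr -sumrB; apply: eq_bigr => d _; rewrite mulrBl mulrA. Qed.
Lemma dotBZr a x y z : dot z (fun d => x d - a * y d) = dot z x - a * dot z y.
Proof. by rewrite /dot mulr_sumr -sumrB; apply: eq_bigr => d _; rewrite mulrBr mulrCA. Qed.
Lemma dotZr a x y : dot x (fun d => a * y d) = a * dot x y.
Proof. by rewrite /dot mulr_sumr; apply: eq_bigr => d _; rewrite mulrCA. Qed.

(* Bartl's induction: if the implication fails without the last form a, some z violates it
   with a z > 0, and projecting along z onto the kernel of a removes a. *)
Lemma farkas_ord (m : nat) (A : 'I_m -> D -> R) g :
  (forall x, (forall i, dot (A i) x <= 0) -> dot g x <= 0) ->
  exists2 l : 'I_m -> R, (forall i, 0 <= l i) & forall d, g d = \sum_i l i * A i d.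
Proof.
elim: m A g => [|m IH] A g Ag.
  exists (fun=> 0) => // d; rewrite big_ord0; apply/eqP.
  have : dot g g <= 0 by apply: Ag => -[].
  rewrite le_eqVlt ltNge sumr_ge0 ?orbF => [|i _]; last by rewrite -expr2 sqr_ge0.
  rewrite psumr_eq0 => [|i _]; last by rewrite -expr2 sqr_ge0.
  by move=> /allP/(_ d); rewrite mem_index_enum mulf_eq0 orbb => /(_ isT).
have widenE (i : 'I_m) : widen_ord (leqnSn m) i = lift ord_max i.
  by apply: val_inj; rewrite /= /bump leqNgt ltn_ord.
pose A' (i : 'I_m) := A (lift ord_max i); pose a := A ord_max.
case: (classic (forall x, (forall i, dot (A' i) x <= 0) -> dot g x <= 0)) => [h|].
  have [l l0 gl] := IH A' g h.
  exists (fun i => if unlift ord_max i is Some j then l j else 0).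
    by move=> i; case: unliftP.
  move=> d; rewrite big_ord_recr /= unlift_none mul0r addr0 gl; apply: eq_bigr => i _.
  by rewrite widenE liftK.
move=> /(not_all_ex_not _ _)[z0 hz0].
have [Az0 /negP] := imply_to_and _ _ hz0; rewrite -ltNge => gz0.
have az0 : 0 < dot a z0.
  rewrite ltNge; apply/negP => h; move: gz0; rewrite ltNge => /negP; apply.
  by apply: Ag => i; case: (unliftP ord_max i) => [j|] -> //; apply: Az0.
pose z d := (dot a z0)^-1 * z0 d.
have az : dot a z = 1 by rewrite dotZr mulVf // gt_eqF.
have Az i : dot (A' i) z <= 0 by rewrite dotZr pmulr_rle0 ?invr_gt0.
have gz : 0 < dot g z by rewrite dotZr mulr_gt0 ?invr_gt0.
have [|l l0 gl] := IH (fun i d => A' i d - dot (A' i) z * a d) (fun d => g d - dot g z * a d).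
  move=> x Ax; have := Ag (fun d => x d - dot a x * z d).
  rewrite dotBZl dotBZr mulrC; apply => i.
  case: (unliftP ord_max i) => [j|] ->; rewrite dotBZr; last by rewrite az mulr1 subrr.
  by have := Ax j; rewrite dotBZl mulrC.
(* Undoing the projection forces the multiplier of the removed form. It is nonnegative because at
   [z] the form [g] is positive and the other forms are nonpositive. *)
exists (fun i => if unlift ord_max i is Some j then l j else dot g z - \sum_i l i * dot (A' i) z).
  move=> i; case: unliftP => // _; rewrite subr_ge0; apply: le_trans (ltW gz).
  by apply: sumr_le0 => j _; rewrite mulr_ge0_le0.
move=> d; rewrite big_ord_recr /= unlift_none -/a mulrBl.
under eq_bigr => i _ do rewrite widenE liftK -/(A' i).
move/eqP: (gl d); rewrite subr_eq => /eqP ->.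
under [in LHS]eq_bigr => i _ do rewrite mulrBr mulrA.
by rewrite sumrB -mulr_suml addrAC -addrA.
Qed.

Lemma farkas (I : finType) (A : I -> D -> R) g :
  (forall x, (forall i, dot (A i) x <= 0) -> dot g x <= 0) ->
  exists2 l : I -> R, (forall i, 0 <= l i) & forall d, g d = \sum_i l i * A i d.
Proof.
move=> Ag; have [|l l0 gl] := @farkas_ord #|I| (fun k => A (enum_val k)) g.
  by move=> x Ax; apply: Ag => i; rewrite -(enum_rankK i).
exists (fun i => l (enum_rank i)) => // d.
rewrite gl (reindex enum_rank) /=; first by apply: eq_bigr => i _; rewrite enum_rankK.
exact/onW_bij/enum_rank_bij.
Qed.

End Farkas.

Lemma rat_common_denom (I : finType) (c : I -> rat) : (forall i, 0 <= c i) ->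
  exists2 q : nat, (0 < q)%N & exists k : I -> nat, forall i, c i * q%:R = (k i)%:R.
Proof.
move=> c0; pose q := (\prod_i `|denq (c i)|)%N.
exists q; first by rewrite prodn_gt0 // => i; rewrite absz_gt0 denq_neq0.
have dvd i : (`|denq (c i)| %| q)%N by rewrite /q (bigD1 i) //= dvdn_mulr.
exists (fun i => (`|numq (c i)| * (q %/ `|denq (c i)|))%N) => i.
have /dvdnP[k qk] := dvd i; rewrite qk mulnK ?absz_gt0 ?denq_neq0 //.
rewrite !natrM mulrCA [RHS]mulrC; congr (_ * _).
rewrite !natr_absz ger0_norm ?ger0_norm ?numq_ge0 ?denq_ge0 //.
by rewrite -{1}[c i]divq_num_den mulfVK // intr_eq0 denq_neq0.
Qed.

(* Costs are the multipliers dual to the coordinatewise bounds b. *)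
Lemma dominates_convex_comb (I E : finType) (T : I -> E -> rat) (b : E -> rat) :
  (forall c : E -> nat, exists i, \sum_e (c e)%:R * T i e <= \sum_e (c e)%:R * b e) ->
  exists l : I -> rat, [/\ forall i, 0 <= l i, \sum_i l i = 1 &
    forall e, \sum_i l i * T i e <= b e].
Proof.
move=> costs.
(* The coordinate [None] records total weight. Writing (-b, 1) as a conic combination of the vectors
   (-T i, 1) and of negative unit vectors makes the weights of the T i sum to 1; the unit vectors
   supply the slack. *)
pose A (j : E + I) (d : option E) : rat := match j, d with
  | inl e, Some f => - (e == f)%:R | inl e, None => 0
  | inr i, Some f => - T i f | inr i, None => 1 end.
pose g (d : option E) : rat := if d is Some f then - b f else 1.
have dotE (h x : option E -> rat) : dot h x = h None * x None + \sum_e h (Some e) * x (Some e).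
  rewrite /dot (bigD1 None) //=; congr (_ + _).
  rewrite (reindex_omap Some id) /=; last by case.
  by apply: eq_bigl => e; rewrite eqxx.
have [|l l0 gl] := farkas (A := A) (g := g).
  move=> x Ax.
  have x0 e : 0 <= x (Some e).
    have := Ax (inl e); rewrite dotE /= mul0r add0r (bigD1 e) //= eqxx mulN1r.
    by rewrite big1 ?addr0 ?oppr_le0 // => f /negPf; rewrite eq_sym => ->; rewrite oppr0 mul0r.
  have [q q0 [c cE]] := rat_common_denom x0.
  have dotN (h : E -> rat) : dot (fun d => if d is Some f then - h f else 1) x =
      x None - \sum_e x (Some e) * h e.
    rewrite dotE mul1r -sumrN; congr (_ + _); apply: eq_bigr => e _.
    by rewrite mulNr mulrC.
  have [i Ti] := costs c; have := Ax (inr i).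
  rewrite [dot (A _) _]dotN [dot g _]dotN !subr_le0 => /le_trans; apply.
  have qr : 0 < q%:R :> rat by rewrite ltr0n.
  rewrite -(ler_pM2r qr) !mulr_suml; move: Ti; congr (_ <= _); apply: eq_bigr => e _.
    by rewrite -cE mulrAC.
  by rewrite -cE mulrAC.
exists (fun i => l (inr i)); split=> // [|e].
  have := gl None; rewrite big_sumType /= => ->.
  by rewrite [X in X + _]big1 ?add0r => [|e _]; rewrite ?mulr0 //; apply: eq_bigr => i _; rewrite mulr1.
have := gl (Some e); rewrite big_sumType /= => /eqP.
rewrite -subr_eq0 -oppr_eq0 opprB => /eqP h.
rewrite -subr_ge0.
have -> : b e - \sum_i l (inr i) * T i e = l (inl e).
  move/eqP: h; rewrite opprK [X in X + _ + _](bigD1 e) //= eqxx mulrN1 big1 => [|f /negPf->]; last first.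
    by rewrite oppr0 mulr0.
  rewrite addr0; under eq_bigr do rewrite mulrN; rewrite sumrN.
  by move=> /eqP; lra.
exact: l0.
Qed.

(** * Rounding in the intersection of a base polytope and a partition *)

Lemma card_imset_double (E A : finType) (g : E -> A) (Fr : {set E}) :
  (forall e, e \in Fr -> exists2 e', e' \in Fr & e' != e /\ g e' = g e) ->
  (2 * #|g @: Fr| <= #|Fr|)%N.
Proof.
move=> twins; rewrite mulnC -sum_nat_const -[X in (_ <= X)%N]sum1_card.
rewrite [X in (_ <= X)%N](partition_big_imset g) /=; apply: leq_sum => a /imsetP[e eF ->].
have [e' e'F [ne ge]] := twins e eF.
by rewrite (bigD1 e) ?eF ?eqxx //= (bigD1 e') //= e'F ge eqxx.
Qed.

(* Dimension count: the two partitions give at most #|Fr| equations, one of them redundant. *)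
Lemma two_partitions_kernel (E A B : finType) (g : E -> A) (h : E -> B) (Fr : {set E}) :
  Fr != set0 ->
  (forall e, e \in Fr -> exists2 e', e' \in Fr & e' != e /\ g e' = g e) ->
  (forall e, e \in Fr -> exists2 e', e' \in Fr & e' != e /\ h e' = h e) ->
  exists d : E -> rat, [/\ forall e, e \notin Fr -> d e = 0, exists e, d e != 0,
    forall a, \sum_(e | g e == a) d e = 0 & forall b, \sum_(e | h e == b) d e = 0].
Proof.
move=> /set0Pn[e0 e0F] gtw htw.
(* The equation of the class of [h e0] is left out. As each class has at least two elements, fewer
   equations than unknowns remain. *)
pose cols : {set A + B} := [set inl a | a in g @: Fr] :|: [set inr b | b in h @: Fr :\ h e0].
have ccols : (#|cols| < #|Fr|)%N.
  apply: leq_ltn_trans (leq_card_setU _ _) _; rewrite (card_imset _ (@inl_inj A B)) (card_imset _ (@inr_inj A B)).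
  have := card_imset_double gtw; have := card_imset_double htw.
  by have := cardsD1 (h e0) (h @: Fr); rewrite imset_f //; lia.
pose inc e (j : A + B) : rat := match j with inl a => (g e == a)%:R | inr b => (h e == b)%:R end.
pose N : 'M[rat]_(#|Fr|, #|cols|) := \matrix_(i, j) inc (enum_val i) (enum_val j).
have : kermx N != 0.
  by rewrite kermx_eq0 /row_free neq_ltn (leq_ltn_trans (rank_leq_col N) ccols).
move=> /rowV0Pn[v /sub_kermxP vN v0].
pose d e := if e \in Fr then v 0 (enum_rank_in e0F e) else 0.
have dF i : d (enum_val i) = v 0 i by rewrite /d enum_valP enum_valK_in.
have dout e : e \notin Fr -> d e = 0 by rewrite /d => /negPf->.
have sumd (P : pred E) : \sum_(e | P e) d e = \sum_(i < #|Fr|) d (enum_val i) * (P (enum_val i))%:R.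
  transitivity (\sum_(e in Fr) d e * (P e)%:R).
    rewrite big_mkcond [RHS]big_mkcond; apply: eq_bigr => e _.
    by case eF: (e \in Fr); case: (P e); rewrite ?mulr1 ?mulr0 // dout ?eF.
  by rewrite big_enum_val.
have dcol j : j \in cols -> \sum_(i < #|Fr|) d (enum_val i) * inc (enum_val i) j = 0.
  move=> jc; have /matrixP/(_ 0 (enum_rank_in jc j)) := vN; rewrite !mxE => vNj.
  rewrite -[RHS]vNj; apply: eq_bigr => i _.
  by rewrite mxE dF enum_rankK_in.
have dg a : \sum_(e | g e == a) d e = 0.
  case aF: (a \in g @: Fr); first by rewrite sumd (dcol (inl a)) // inE imset_f.
  apply: big1 => e /eqP ea; apply: dout; apply: contraFN aF => eF.
  by rewrite -ea imset_f.
have dh b : b != h e0 -> \sum_(e | h e == b) d e = 0.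
  move=> b0; case bF: (b \in h @: Fr).
    by rewrite sumd (dcol (inr b)) // inE orbC imset_f // in_setD1 b0.
  apply: big1 => e /eqP eb; apply: dout; apply: contraFN bF => eF.
  by rewrite -eb imset_f.
exists d; split=> // [|b].
  move/rV0Pn: v0 => [i vi]; exists (enum_val i); rewrite dF.
  by [].
have [->|] := eqVneq b (h e0); last exact: dh.
(* The omitted equation follows because both partitions have the same total. *)
have tot : \sum_e d e = 0.
  by rewrite (partition_big g predT) //= big1.
move: tot; rewrite (partition_big h predT) //= (bigD1 (h e0)) //=.
by rewrite [X in _ + X]big1 ?addr0.
Qed.

Section Polymatroid.
Variables (E L : finType) (r : {set E} -> nat) (f : E -> L).
Hypothesis r0 : r set0 = 0%N.
Hypothesis r_submod : forall A B, (r (A :|: B) + r (A :&: B) <= r A + r B)%N.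
Implicit Types (x c d : E -> rat) (A : {set E}).

(** The nonnegative part of the base polytope of the submodular function [r]. *)
Definition in_base x := [/\ forall e, 0 <= x e, forall A, \sum_(e in A) x e <= (r A)%:R
  & \sum_e x e = (r setT)%:R].
Definition tight x A := \sum_(e in A) x e == (r A)%:R.

Lemma sum_setU_setI x A B : \sum_(e in A :|: B) x e + \sum_(e in A :&: B) x e =
  \sum_(e in A) x e + \sum_(e in B) x e.
Proof.
rewrite !(big_mkcond (fun e => e \in _)) /= -!big_split; apply: eq_bigr => e _ /=.
by rewrite !inE; case: (e \in A); case: (e \in B); rewrite ?addr0 ?add0r.
Qed.

Section Classes.
Variable x : E -> rat.
Hypothesis xb : in_base x.

(** Uncrossing: submodularity forces equality in both upper bounds. *)
Lemma tightUI A B : tight x A -> tight x B -> tight x (A :|: B) && tight x (A :&: B).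
Proof.
case: xb => _ xr _ /eqP xA /eqP xB; have := sum_setU_setI x A B; rewrite xA xB.
have := xr (A :|: B); have := xr (A :&: B).
have := r_submod A B; rewrite -(ler_nat rat) !natrD /tight !eq_le.
by move=> *; lra.
Qed.

Lemma tight0 : tight x set0. Proof. by rewrite /tight big_set0 r0. Qed.
Lemma tightT : tight x setT.
Proof. by case: xb => _ _ xT; rewrite /tight -xT; apply/eqP/eq_bigl => e; rewrite inE. Qed.

(** The atoms of the lattice of tight sets. *)
Definition cls e := [set g | [forall A : {set E}, tight x A ==> ((e \in A) == (g \in A))]].

Lemma clsP e g : reflect (forall A, tight x A -> (e \in A) = (g \in A)) (g \in cls e).
Proof.
rewrite inE; apply: (iffP forallP) => h A; first by move/implyP: (h A) => h' /h' /eqP.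
by apply/implyP => /h ->.
Qed.

Lemma cls_eq e g : g \in cls e -> cls g = cls e.
Proof.
move/clsP => eg; apply/setP => k; apply/clsP/clsP => h A tA; first by rewrite eg ?h.
by rewrite -eg ?h.
Qed.

Lemma cls_refl e : e \in cls e. Proof. exact/clsP. Qed.

Lemma tight_int A : tight x A -> \sum_(e in A) x e \is a Num.int.
Proof. by move=> /eqP->; apply: rpred_nat. Qed.

(** The class is the smallest tight set containing [e] minus the largest tight set avoiding [e], and
    sums over tight sets are values of [r]. *)
Lemma cls_sum_int e : \sum_(g in cls e) x g \is a Num.int.
Proof.
pose D := \bigcap_(A : {set E} | tight x A && (e \in A)) A.
pose W := \bigcup_(A : {set E} | tight x A && (e \notin A)) A.
have tD : tight x D.
  by apply: (big_ind (tight x)) => [|A B|A /andP[]//]; [exact: tightT | move=> tA /(tightUI tA)/andP[]].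
have tW : tight x W.
  by apply: (big_ind (tight x)) => [|A B|A /andP[]//]; [exact: tight0 | move=> tA /(tightUI tA)/andP[]].
have -> : cls e = D :\: W.
  apply/setP => g; rewrite in_setD; apply/clsP/andP => [h|[gW gD] A tA].
    split; first by apply/bigcupP => -[A /andP[tA eA]]; rewrite -h // (negPf eA).
    by apply/bigcapP => A /andP[tA eA]; rewrite -h.
  case eA: (e \in A); first by move/bigcapP: gD => ->//; rewrite tA eA.
  by apply/esym/negP => gA; move/bigcupP: gW => []; exists A; rewrite ?tA ?eA.
have -> : \sum_(g in D :\: W) x g = \sum_(g in D) x g - \sum_(g in D :&: W) x g.
  by rewrite [X in _ = X - _](big_setID W) /= addrAC subrr add0r.
have /andP[_ tDW] := tightUI tD tW.
by rewrite rpredB ?tight_int.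
Qed.

End Classes.

(** An integral class sum cannot contain exactly one fractional term. *)
Lemma fractional_twin (K : finType) (k : E -> K) x e :
  \sum_(g | k g == k e) x g \is a Num.int -> x e \isn't a Num.int ->
  exists2 e', x e' \isn't a Num.int & e' != e /\ k e' = k e.
Proof.
move=> sumi xe.
have [/exists_inP[e' xe' /andP[ne /eqP]]|/exists_inPn h] :=
  boolP [exists (e' | x e' \isn't a Num.int), (e' != e) && (k e' == k e)].
  by exists e'.
case/negP: xe; move: sumi; rewrite (bigD1 e) //= rpredDr // rpred_sum // => g /andP[kg ge].
by apply/negPn/negP => /h; rewrite ge kg.
Qed.

Definition label_sums x y := forall l, \sum_(e | f e == l) x e = \sum_(e | f e == l) y e.

(** Termination measure of the rounding: the number of constraints that are not yet tight. *)
Definition loose_count x : nat :=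
  (#|[set A | ~~ tight x A]| + #|[set e | (x e != 0)%R]|)%N.

(** The direction [d] lives on the fractional elements and sums to zero on all classes of [cls] and
    [f], so tight sets and label sums survive. Moving along it, with the sign that does not raise
    the cost, until a slack vanishes makes a further constraint tight. *)
Lemma rounding_step x c : in_base x -> (forall l, \sum_(e | f e == l) x e \is a Num.int) ->
  ~~ [forall e, x e \is a Num.int] ->
  exists y, [/\ in_base y, label_sums y x, \sum_e c e * y e <= \sum_e c e * x e &
   (loose_count y < loose_count x)%N].
Proof.
move=> xb xl; rewrite negb_forall => /existsP[e1 xe1].
have [x_ge0 xr xT] := xb.
pose Fr := [set e | x e \isn't a Num.int].
have [||e|d0 [d0out d0n d0c d0l]] := two_partitions_kernel (g := cls x) (h := f) (Fr := Fr).
- by apply/set0Pn; exists e1; rewrite inE.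
- move=> e; rewrite inE => xe; have [|e' xe' ne] := fractional_twin (k := cls x) _ xe.
    rewrite (eq_bigl (fun g => g \in cls x e)) ?cls_sum_int // => g.
    by apply/eqP/idP => [<-|/cls_eq//]; apply: cls_refl.
  by exists e'; rewrite ?inE.
- by rewrite inE => xe; have [e' xe' ne] := fractional_twin (xl _) xe; exists e'; rewrite ?inE.
have [d [dout dn dc dl dcost]] : exists d, [/\ forall e, e \notin Fr -> d e = 0, exists e, d e != 0,
    forall a, \sum_(e | cls x e == a) d e = 0, forall b, \sum_(e | f e == b) d e = 0 &
    \sum_e c e * d e <= 0].
  have [neg|pos] := leP (\sum_e c e * d0 e) 0; first by exists d0.
  exists (fun e => - d0 e); split.
  + by move=> e /d0out->; rewrite oppr0.
  + by have [e de] := d0n; exists e; rewrite oppr_eq0.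
  + by move=> a; rewrite sumrN d0c oppr0.
  + by move=> b; rewrite sumrN d0l oppr0.
  by under eq_bigr do rewrite mulrN; rewrite sumrN oppr_le0 ltW.
have dtight A : tight x A -> \sum_(e in A) d e = 0.
  move=> tA; rewrite (partition_big (cls x) predT) //= big1 // => C _.
  have [/exists_inP[e eA /eqP <-]|/exists_inPn h] := boolP [exists (e | e \in A), cls x e == C].
    rewrite (eq_bigl (fun g => cls x g == cls x e)) // => g; apply: andb_idl => /eqP ge.
    have /clsP/(_ A tA) : e \in cls x g by rewrite ge cls_refl.
    by rewrite eA.
  by rewrite big_pred0 // => e; apply/negP => /andP[eA]; apply/negP/h.
pose slack y (j : E + {set E}) : rat :=
  match j with inl e => y e | inr A => (r A)%:R - \sum_(e in A) y e end.
pose s (j : E + {set E}) : rat := match j with inl e => d e | inr A => - \sum_(e in A) d e end.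
have slackD t j : slack (fun e => x e + t * d e) j = slack x j + t * s j.
  by case: j => [e|A] //=; rewrite big_split /= -mulr_sumr mulrN opprD addrA.
have slack_ge0 j : 0 <= slack x j by case: j => [e|A] /=; rewrite ?x_ge0 ?subr_ge0 ?xr.
have slack_s j : slack x j = 0 -> s j = 0.
  case: j => [e|A] /=; first by move=> xe; rewrite dout // inE xe rpred0.
  by move/eqP; rewrite subr_eq0 eq_sym => /dtight->; rewrite oppr0.
(* A nonzero direction of total zero has a negative entry, so some constraint stops the motion. *)
have [j0 sj0] : exists j, s j < 0.
  have [/existsP[e de]|/existsPn h] := boolP [exists e, d e < 0]; first by exists (inl e).
  have [e] := dn; suff -> : d e = 0 by rewrite eqxx.
  have dge g : 0 <= d g by rewrite leNgt h.
  have := dtight _ (tightT xb); under eq_bigl do rewrite inE.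
  move/eqP; rewrite psumr_eq0 // => /allP/(_ e); rewrite mem_index_enum => /(_ isT) /eqP.
  by [].
pose ratio j := slack x j / - s j.
have [j1 sj1 jmin] := Order.TotalTheory.arg_minP ratio (sj0 : (fun j => s j < 0) j0).
pose t := ratio j1.
have t_gt0 : 0 < t.
  rewrite /t /ratio divr_gt0 ?oppr_gt0 // lt_def slack_ge0 andbT.
  by apply/eqP => /slack_s s0; rewrite s0 ltxx in sj1.
pose y e := x e + t * d e.
have y_ge0 j : 0 <= slack y j.
  rewrite slackD; have [sj|sj] := leP 0 (s j); first exact: addr_ge0 (slack_ge0 j) (mulr_ge0 (ltW t_gt0) sj).
  by have := jmin j sj; rewrite ler_pdivlMr ?oppr_gt0 // -/t mulrN; lra.
have y_j1 : slack y j1 = 0.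
  by rewrite slackD /t /ratio invrN mulrN mulNr mulfVK ?subrr // lt_eqF.
have y_slack j : slack x j = 0 -> slack y j = 0.
  by move=> xj; rewrite slackD xj slack_s // mulr0 addr0.
have y_sum (P : pred E) : \sum_(e | P e) y e = \sum_(e | P e) x e + t * \sum_(e | P e) d e.
  by rewrite big_split mulr_sumr.
exists y; split.
- split=> [e|A|]; first exact: (y_ge0 (inl e)).
    by have := y_ge0 (inr A); rewrite subr_ge0.
  rewrite y_sum xT; have := dtight _ (tightT xb); under eq_bigl do rewrite inE.
  by move->; rewrite mulr0 addr0.
- by move=> l; rewrite y_sum dl mulr0 addr0.
- under eq_bigr do rewrite mulrDr mulrCA; rewrite big_split /= -mulr_sumr.
  by rewrite gerDl mulr_ge0_le0 // ltW.
have subA : [set A | ~~ tight y A] \subset [set A | ~~ tight x A].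
  apply/subsetP => A; rewrite !inE; apply: contraNN => tA; have := y_slack (inr A).
  by rewrite /= (eqP tA) subrr => /(_ (erefl _)) /eqP; rewrite subr_eq0 eq_sym.
have subE : [set e | y e != 0] \subset [set e | x e != 0].
  apply/subsetP => e; rewrite !inE; apply: contraNN => /eqP xe.
  by apply/eqP/(y_slack (inl e)).
rewrite /loose_count; case: j1 sj1 {jmin} @t t_gt0 @y y_ge0 y_j1 y_slack y_sum subA subE => [e|A] sj1 t t_gt0 y y_ge0 y_j1 y_slack y_sum subA subE.
  rewrite -addnS leq_add ?subset_leq_card // proper_card // properE subE.
  apply/subsetPn; exists e; rewrite !inE; last by rewrite negbK; apply/eqP.
  by apply/eqP => xe; have := slack_s (inl e) xe; move: sj1 => /= + d0e; rewrite d0e ltxx.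
rewrite -addSn leq_add ?subset_leq_card // proper_card // properE subA.
apply/subsetPn; exists A; rewrite !inE.
  apply/negP => tA; have := slack_s (inr A); rewrite /= (eqP tA) subrr => /(_ (erefl _)).
  by move: sj1 => /= + d0e; rewrite d0e ltxx.
by rewrite negbK /tight eq_sym -subr_eq0; apply/eqP.
Qed.

Theorem integral_point z c : in_base z -> (forall l, \sum_(e | f e == l) z e \is a Num.int) ->
  exists x, [/\ in_base x, forall e, x e \is a Num.int, label_sums x z &
    \sum_e c e * x e <= \sum_e c e * z e].
Proof.
have [n] := ubnP (loose_count z).
elim: n z => // n IH z zn zb zl.
have [/forallP zi|] := boolP [forall e, z e \is a Num.int]; first by exists z; split.
move=> /(rounding_step c zb zl)[y [yb yl yc yn]].
have [||x [xb xi xl xc]] := IH y _ yb; first exact: leq_trans yn _.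
  by move=> l; rewrite yl.
by exists x; split=> // [l|]; [rewrite xl yl|exact: le_trans yc].
Qed.

End Polymatroid.

(** * The graphic matroid *)

Section GraphicRank.
Variables (V E : finType) (ends : E -> V * V).
Implicit Types (A : {set E}) (U : {set V}).

(** Signed incidence rows represent the graphic matroid over [rat], so submodularity of its rank
    comes from dimensions of subspaces. *)
Definition vrow (v : V) : 'rV[rat]_#|V| := delta_mx 0 (enum_rank v).
Definition erow (e : E) : 'rV[rat]_#|V| := vrow (ends e).1 - vrow (ends e).2.
Definition cycle_span A : 'M[rat]_#|V| := (\sum_(e in A) <<erow e>>)%MS.
Definition grank A : nat := \rank (cycle_span A).

Lemma cycle_span_sub m (X : 'M_(m, _)) A :
  (forall e, e \in A -> (erow e <= X)%MS) -> (cycle_span A <= X)%MS.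
Proof. by move=> h; apply/sumsmx_subP => e eA; rewrite genmxE h. Qed.

Lemma erow_sub e A : e \in A -> (erow e <= cycle_span A)%MS.
Proof. by move=> eA; apply: (sumsmx_sup e) => //; rewrite genmxE. Qed.

Lemma grank0 : grank set0 = 0%N.
Proof. by rewrite /grank /cycle_span big_set0 mxrank0. Qed.

Lemma grank_submod A B : (grank (A :|: B) + grank (A :&: B) <= grank A + grank B)%N.
Proof.
rewrite /grank -[leqRHS]mxrank_sum_cap; apply: leq_add; apply: mxrankS.
  apply: cycle_span_sub => e; rewrite inE => /orP[] eA.
    exact: submx_trans (erow_sub eA) (addsmxSl _ _).
  exact: submx_trans (erow_sub eA) (addsmxSr _ _).
by rewrite sub_capmx !cycle_span_sub // => e; rewrite inE => /andP[? ?]; apply: erow_sub.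
Qed.

Lemma grank1 e : (grank [set e] <= 1)%N.
Proof. by rewrite /grank /cycle_span big_set1 genmxE rank_leq_row. Qed.

Definition indic U : 'cV[rat]_#|V| := \col_i (enum_val i \in U)%:R.

Lemma vrow_indic v U : vrow v *m indic U = (v \in U)%:R%:M.
Proof.
apply/matrixP => i j; rewrite !ord1 !mxE (bigD1 (enum_rank v)) //= !mxE !eqxx enum_rankK mul1r.
by rewrite big1 ?addr0 // => k /negPf kv; rewrite !mxE kv andbF mul0r.
Qed.

Lemma erow_indic e U : erow e *m indic U = (((ends e).1 \in U)%:R - ((ends e).2 \in U)%:R)%:M.
Proof. by rewrite mulmxBl !vrow_indic raddfB. Qed.

Lemma cycle_span_indic A U : (forall e, e \in A -> e \notin delta ends U) ->
  cycle_span A *m indic U = 0.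
Proof.
move=> AU; apply/eqP; rewrite -sub_kermx; apply: cycle_span_sub => e /AU.
by rewrite inE negbK => /eqP eU; rewrite sub_kermx erow_indic eU subrr raddf0.
Qed.

Lemma grankT : (0 < #|V|)%N -> (grank setT <= #|V|.-1)%N.
Proof.
move=> V0; have : cycle_span setT *m indic setT = 0.
  by apply: cycle_span_indic => e _; rewrite !inE.
move=> /eqP; rewrite -sub_kermx => /mxrankS; rewrite mxrank_ker => /leq_trans; apply.
suff : indic setT != 0 by rewrite -mxrank_eq0; lia.
have [v] := card_gt0P V0; move=> _; apply/eqP => /colP/(_ (enum_rank v)).
by rewrite !mxE inE => /eqP; rewrite oner_eq0.
Qed.

(** Linear form of connectivity by edges of [A]; the classes stand for the components. *)
Definition same_class A u v := (vrow u - vrow v <= cycle_span A)%MS.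
Definition class_of A u := [set v | same_class A u v].

Lemma same_class_sym A u v : same_class A u v = same_class A v u.
Proof. by rewrite /same_class -opprB eqmx_opp. Qed.

Lemma same_class_trans A u v w : same_class A u v -> same_class A v w -> same_class A u w.
Proof.
by move=> uv vw; rewrite /same_class -(subrKA (vrow v)) addmx_sub.
Qed.

Lemma mem_class A u v : (v \in class_of A u) = (class_of A v == class_of A u).
Proof.
apply/idP/eqP => [|<-]; last by rewrite inE /same_class subrr sub0mx.
rewrite inE => uv; apply/setP => w; rewrite !inE; apply/idP/idP; first exact: same_class_trans.
by apply: same_class_trans; rewrite same_class_sym.
Qed.

(** The span of [A] together with one unit vector per class is the whole space. *)
Lemma card_le_grank_classes A : (#|V| <= grank A + #|class_of A @: V|)%N.
Proof.
pose rep (C : {set V}) := if [pick v in C] is Some v then vrow v else 0.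
pose X := (\sum_(C in class_of A @: V) <<rep C>>)%MS.
have rX : (\rank X <= #|class_of A @: V|)%N.
  rewrite -sum1_card; apply: leq_trans (mxrank_sum_leqif _) _ => /=.
  by apply: leq_sum => C _; rewrite genmxE rank_leq_row.
have : (1%:M <= cycle_span A + X)%MS.
  apply/row_subP => i; rewrite rowE mulmx1 -[i]enum_valK -/(vrow _); set v := enum_val i.
  have [u uv ru] : exists2 u, same_class A v u & rep (class_of A v) = vrow u.
    rewrite /rep; case: pickP => [u|/(_ v)]; first by rewrite inE; exists u.
    by rewrite mem_class eqxx.
  rewrite -(subrK (vrow u) (vrow v)) addmx_sub //.
    exact: submx_trans uv (addsmxSl _ _).
  apply: submx_trans (addsmxSr _ _); apply: (sumsmx_sup (class_of A v)); first exact: imset_f.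
  by rewrite genmxE ru.
move=> /mxrankS; rewrite mxrank1 => /leq_trans; apply.
by apply: leq_trans (mxrank_adds_leqif _ _) _; rewrite leq_add2l.
Qed.

(** Each edge of [A] has both ends in one class, and the forest inequalities of the classes add up
    to |V| minus the number of classes. *)
Lemma forest_grank (x : E -> rat) A : (forall e, 0 <= x e) ->
  (forall U, U != set0 -> \sum_(e | ((ends e).1 \in U) && ((ends e).2 \in U)) x e <= #|U|%:R - 1) ->
  \sum_(e in A) x e <= (grank A)%:R.
Proof.
move=> x0 xU; pose cl := class_of A; pose CC := cl @: V.
have VE : #|V| = (\sum_(C in CC) #|C|)%N.
  rewrite -sum1_card (partition_big_imset cl) /=; apply: eq_bigr => C /imsetP[u _ ->].
  by rewrite -sum1_card; apply: eq_bigl => v; rewrite mem_class.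
have -> : \sum_(e in A) x e = \sum_(C in CC) \sum_(e in A | cl (ends e).1 == C) x e.
  by apply: partition_big => e _; apply: imset_f.
apply: (@le_trans _ _ (\sum_(C in CC) (#|C|%:R - 1))).
  apply: ler_sum => C /imsetP[u _ ->].
  apply: le_trans (xU (cl u) _); last by apply/set0Pn; exists u; rewrite mem_class.
  rewrite [leRHS](bigID (mem A)) /= -[leLHS]addr0 lerD ?sumr_ge0 //.
  rewrite le_eqVlt; apply/orP; left; apply/eqP/eq_bigl => e.
  rewrite andbC; case eA: (e \in A); rewrite ?andbF // !andbT.
  rewrite !mem_class -/cl -/(cl _); have -> : cl (ends e).2 = cl (ends e).1; last by rewrite andbb.
  by apply/eqP; rewrite -mem_class inE /same_class erow_sub.
rewrite sumrB sumr_const -natr_sum -VE lerBlDr -natrD ler_nat.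
exact: card_le_grank_classes.
Qed.

(** The support of [x] has full rank, hence spans the row of any cut edge. If the support missed the
    cut, the functional [indic U] would vanish on this span but not on that row. *)
Lemma base_crosses (x : E -> rat) U : in_base grank x -> delta ends U != set0 ->
  exists2 e, e \in delta ends U & x e != 0.
Proof.
move=> [x0 xr xT] /set0Pn[e0 e0U].
have [/exists_inP[e eU xe]|/exists_inPn h] := boolP [exists (e | e \in delta ends U), x e != 0].
  by exists e.
pose F := [set e | x e != 0].
have rF : (grank setT <= grank F)%N.
  rewrite -(ler_nat rat) -xT; apply: le_trans (xr F).
  rewrite [leRHS]big_mkcond le_eqVlt; apply/orP; left; apply/eqP/eq_bigr => e _.
  by rewrite inE; case: eqP.
have FT : (cycle_span F <= cycle_span setT)%MS.
  by apply: cycle_span_sub => e _; apply: erow_sub; rewrite inE.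
have TF : (cycle_span setT <= cycle_span F)%MS.
  by have [_ <-] := mxrank_leqif_sup FT; rewrite eqn_leq rF mxrankS.
have := submx_trans (erow_sub (in_setT e0)) TF => /submxP[X eX].
have := erow_indic e0 U; rewrite eX -mulmxA cycle_span_indic ?mulmx0; last first.
  by move=> e; rewrite inE => xe; apply/negP => /h; rewrite xe.
move/matrixP/(_ 0 0); rewrite !mxE eqxx mulr1n => /esym/eqP; move: e0U; rewrite inE subr_eq0.
by case: (_ \in U); case: (_ \in U).
Qed.

(** Integral points of the base polytope are 0/1 because singletons have rank at most one.
    Connectivity is expressed by [F] meeting every nonempty cut. *)
Theorem label_spanning_tree (L : finType) (f : E -> L) (z : E -> rat) (c : E -> nat) :
  (0 < #|V|)%N -> (forall e, 0 <= z e) ->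
  (forall U, U != set0 -> \sum_(e | ((ends e).1 \in U) && ((ends e).2 \in U)) z e <= #|U|%:R - 1) ->
  \sum_e z e = #|V|%:R - 1 ->
  (forall l, \sum_(e | f e == l) z e \is a Num.int) ->
  exists F : {set E}, [/\ forall U, delta ends U != set0 -> exists2 e, e \in delta ends U & e \in F,
    forall l, #|[set e in F | f e == l]|%:R = \sum_(e | f e == l) z e &
    \sum_(e in F) (c e)%:R <= \sum_e (c e)%:R * z e].
Proof.
move=> V0 z0 zU zT zl.
have zb : in_base grank z.
  split=> // [A|]; first exact: forest_grank.
  apply/eqP; rewrite eq_le; apply/andP; split.
    have := forest_grank setT z0 zU; congr (_ <= _).
    by apply: eq_bigl => e; rewrite inE.
  by rewrite zT lerBrDr natr1 ler_nat; have := grankT V0; lia.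
have [x [xb xi xl xc]] := integral_point grank0 grank_submod (fun e => (c e)%:R) zb zl.
have [x0 xr _] := xb.
have x01 e : x e = (x e != 0)%:R.
  have [->//|ne] := eqVneq (x e) 0; apply/eqP; rewrite eq_le; apply/andP; split.
    have := xr [set e]; rewrite big_set1 => /le_trans; apply.
    by rewrite -[1]/(1%:R) ler_nat grank1.
  have /intrP[k xk] := xi e; have := x0 e; move: ne; rewrite xk intr_eq0 ler0z.
  by rewrite -[1]/(1%:~R) ler_int; lia.
exists [set e | x e != 0]; split.
- by move=> U /(base_crosses xb)[e eU xe]; exists e; last rewrite inE.
- move=> l; rewrite -xl -sum1_card natr_sum big_mkcond [RHS]big_mkcond; apply: eq_bigr => e _.
  by rewrite !inE [in RHS]x01; case: (f e == l); case: (x e != 0).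
apply: le_trans xc; rewrite big_mkcond le_eqVlt; apply/orP; left; apply/eqP/eq_bigr => e _.
by rewrite inE [in RHS]x01; case: (x e != 0); rewrite ?mulr1 ?mulr0.
Qed.

End GraphicRank.

(** * Four-regular graphs *)

Lemma greedy_coloring (I : finType) (adj : rel I) (k : nat) : symmetric adj ->
  (forall i, #|[set j | (j != i) && adj i j]| <= k)%N ->
  exists col : I -> 'I_k.+1, forall i j, i != j -> adj i j -> col i != col j.
Proof.
move=> adjC deg.
suff [col colP] : exists col : I -> 'I_k.+1,
    forall i j, i \in [set: I] -> j \in [set: I] -> i != j -> adj i j -> col i != col j.
  by exists col => i j; apply: colP.
have [n] := ubnP #|[set: I]|; elim: n [set: I] => // n IH D Dn.
have [->|/set0Pn[i iD]] := eqVneq D set0.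
  by exists (fun=> ord0) => i j; rewrite inE.
have [|col colP] := IH (D :\ i); first by move: Dn; rewrite (cardsD1 i) iD.
pose used := col @: [set j | (j != i) && adj i j].
have /existsP[a aN] : [exists a, a \notin used].
  rewrite -negb_forall; apply/negP => /forallP all_used.
  have : (#|'I_k.+1| <= #|used|)%N by apply: subset_leq_card; apply/subsetP.
  by rewrite card_ord leqNgt ltnS (leq_trans (leq_imset_card _ _) (deg i)).
have aP j : j != i -> adj i j -> col j != a.
  by move=> ji ij; apply: contraNneq aN => <-; apply: imset_f; rewrite inE ji.
exists (fun j => if j == i then a else col j) => j l jD lD jl jla.
have [ji|ji] := eqVneq j i; have [li|li] := eqVneq l i.
- by rewrite ji li eqxx in jl.
- by rewrite eq_sym aP // -ji.
- by rewrite aP // -li adjC.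
- by apply: colP; rewrite ?inE ?ji ?li.
Qed.

Section Graph.
Variables (V E : finType) (ends : E -> V * V).
Hypothesis no_loop : loopless ends.
Implicit Types (U : {set V}) (M S F : {set E}).

Lemma incident_addb v e : incident ends v e = (v == (ends e).1) (+) (v == (ends e).2).
Proof.
rewrite /incident; have [->|_] //= := eqVneq v (ends e).1.
by rewrite (negPf (no_loop e)).
Qed.

Lemma delta1 v e : (e \in delta ends [set v]) = incident ends v e.
Proof.
by rewrite in_delta !in_set1 incident_addb ![_ == v]eq_sym; case: (v == _); case: (v == _).
Qed.

Lemma deltaC U : delta ends (~: U) = delta ends U.
Proof. by apply/setP => e; rewrite !in_delta !in_setC; case: (_ \in _); case: (_ \in _). Qed.

Lemma deltaT : delta ends setT = set0.
Proof. by apply/setP => e; rewrite in_delta !in_setT inE. Qed.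

Lemma boundary_incident J v :
  boundary ends J v = odd (\sum_(e | incident ends v e) J e)%N.
Proof.
rewrite ffunE (big_morph odd oddD (erefl : odd 0 = false)) [RHS]big_mkcond.
apply: eq_bigr => e _; rewrite -incident_addb.
by case: (incident _ _ _); case: (J e).
Qed.

(** Weighted handshake: an edge inside [U] counts twice, a cut edge once. The general codomain
    serves both [nat] and [rat]. *)
Lemma sum_incident (W : nmodType) (w : E -> W) U :
  let inner := \sum_(e | ((ends e).1 \in U) && ((ends e).2 \in U)) w e in
  \sum_(v in U) \sum_(e | incident ends v e) w e = inner + inner + \sum_(e in delta ends U) w e.
Proof.
move=> inner; under eq_bigr => v _ do rewrite big_mkcond.
rewrite exchange_big /= /inner [in RHS]big_mkcond [X in _ = _ + X]big_mkcond -!big_split /=.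
apply: eq_bigr => e _.
have single a : \sum_(v in U) (if v == a then w e else 0) = if a \in U then w e else 0.
  case: ifP => aU; last by rewrite big1 // => v; case: eqP => // ->; rewrite aU.
  by rewrite (bigD1 a) //= eqxx big1 ?addr0 // => v /andP[_ /negPf->].
under eq_bigr => v _.
  rewrite (_ : (if _ then _ else _) = (if v == (ends e).1 then w e else 0) +
    (if v == (ends e).2 then w e else 0)); first over.
  rewrite /incident; case: (eqVneq v (ends e).1) => [->|_]; rewrite ?add0r //=.
  by rewrite (negPf (no_loop e)) addr0.
rewrite big_split /= !single in_delta.
by case: (_ \in U); case: (_ \in U); rewrite ?addr0 ?add0r.
Qed.

Lemma sum_incident_nat (w : E -> nat) U :
  (\sum_(v in U) \sum_(e | incident ends v e) w e =
   2 * (\sum_(e | ((ends e).1 \in U) && ((ends e).2 \in U)) w e) + \sum_(e in delta ends U) w e)%N.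
Proof. by rewrite mul2n -addnn; apply: sum_incident. Qed.

Lemma sum_incident_rat (w : E -> rat) U :
  \sum_(v in U) \sum_(e | incident ends v e) w e =
   2 * (\sum_(e | ((ends e).1 \in U) && ((ends e).2 \in U)) w e) + \sum_(e in delta ends U) w e.
Proof. by rewrite mulr_natl mulr2n; apply: sum_incident. Qed.

Section Cuts.
Hypothesis reg : k_regular ends 4.
Hypothesis conn : k_edge_connected ends 4.

Lemma sum_incident1 v : (\sum_(e | incident ends v e) 1 = 4)%N.
Proof. by rewrite -(reg v) -sum1_card; apply: eq_bigl => e; rewrite inE. Qed.

Lemma card_delta U :
  (2 * #|[set e | ((ends e).1 \in U) && ((ends e).2 \in U)]| + #|delta ends U| = 4 * #|U|)%N.
Proof.
have := sum_incident_nat (fun=> 1%N) U; under eq_bigr do rewrite sum_incident1.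
rewrite sum_nat_const mulnC => ->; rewrite -!sum1_card; congr (_ * _ + _)%N.
by apply: eq_bigl => e; rewrite inE.
Qed.

(** By [card_delta] every cut is even, so excluding 4 excludes 5 as well. *)
Lemma proper_cut_ge6 U : no_proper_4_edge_cut ends -> proper_cut U -> (6 <= #|delta ends U|)%N.
Proof.
move=> no4 pU; have := no4 U pU; case/andP: pU => U2 UC2.
have U0 : U != set0 by apply: contraTneq U2 => ->; rewrite cards0.
have UT : U != setT by apply: contraTneq UC2 => ->; rewrite setCT cards0.
by have := conn U0 UT; have := card_delta U; lia.
Qed.

Lemma reach_all v : reach ends [ffun=> true] v = setT.
Proof.
apply/eqP/negPn/negP => RT.
have R0 : reach ends [ffun=> true] v != set0 by apply/set0Pn; exists v; apply: reach_refl.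
have /card_gt0P[e] : (0 < #|delta ends (reach ends [ffun=> true] v)|)%N by apply: leq_trans (conn R0 RT).
by rewrite in_delta reach_edge ?eqxx // ffunE.
Qed.

Lemma join_exists T : odd_in T setT = false -> exists J, boundary ends J = T.
Proof.
have [n] := ubnP #|[set v | T v]|; elim: n T => // n IH T Tn Teven.
have [T0|/set0Pn[a]] := eqVneq [set v | T v] set0.
  exists 0; rewrite boundary0; apply/ffunP => v; rewrite !ffunE.
  by have := in_set0 v; rewrite -T0 inE => ->.
rewrite inE => Ta; have [b ab Tb] : exists2 b, b != a & T b.
  have [/exists_inP[b ba Tb]|/exists_inPn h] := boolP [exists (b | b != a), T b]; first by exists b.
  move: Teven; rewrite /odd_in (bigD1 a) ?inE //= Ta big1 // => b /andP[_ /h /negPf].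
  by [].
have [P bP _] : exists2 P, boundary ends P = vtx a + vtx b & forall e, P e -> [ffun=> true] e.
  by apply/reachP; rewrite reach_all inE.
have [||J bJ] := IH (T + vtx a + vtx b).
- rewrite -ltnS; apply: leq_ltn_trans Tn; apply: proper_card.
  rewrite properE; apply/andP; split.
    apply/subsetP => v; rewrite !inE !ffunE; case: eqP => [->|_]; first by rewrite Ta.
    by case: eqP => [->|_]; rewrite ?Tb //; case: (T v).
  by apply/subsetPn; exists a; rewrite !inE ?ffunE // Ta eqxx eq_sym (negPf ab).
- by rewrite !odd_inD !odd_in_vtx Teven !in_setT.
by exists (J + P); rewrite boundaryD bJ bP; f2_cancel.
Qed.

Lemma support_connected (t : {ffun E -> nat}) :
  (forall U, delta ends U != set0 -> exists2 e, e \in delta ends U & (0 < t e)%N) ->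
  forall x y, connect (mult_adj ends t) x y.
Proof.
move=> tU x y; pose U := [set y | connect (mult_adj ends t) x y].
suff : y \in U by rewrite inE.
suff -> : U = setT by rewrite inE.
apply/eqP/negPn/negP => UT.
have U0 : U != set0 by apply/set0Pn; exists x; rewrite inE.
have dU : delta ends U != set0 by rewrite -card_gt0; apply: leq_trans (conn U0 UT).
have [e] := tU U dU; rewrite in_delta !inE => + te; apply/negP; rewrite negbK; apply/eqP.
have adj12 : mult_adj ends t (ends e).1 (ends e).2 by apply/existsP; exists e; rewrite te !eqxx.
have adj21 : mult_adj ends t (ends e).2 (ends e).1.
  by apply/existsP; exists e; rewrite te !eqxx orbT.
by apply/idP/idP => /connect_trans; apply; apply: connect1.
Qed.

(** For T = V the constant weight 1/4 covers every odd cut by 4-edge-connectivity. Adding [K] to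
    each cost forces a cheap join to have only |V|/2 edges, hence to be a perfect matching; [m v] is
    its edge at [v]. *)
Lemma perfect_matching_le (c : E -> nat) : ~~ odd #|V| ->
  exists M (m : V -> E), (forall v e, (e \in M) && incident ends v e = (e == m v)) /\
    (4 * \sum_(e in M) c e <= \sum_e c e)%N.
Proof.
(* Larger than the total cost, so no saving can pay for a surplus edge. *)
move=> evenV; pose K := (\sum_e c e).+1.
have oddT U : odd_in [ffun=> true] U = odd #|U|.
  by rewrite /odd_in -sum1_card (big_morph odd oddD (erefl : odd 0 = false)); apply: eq_bigr => v _; rewrite ffunE.
have [||J bJ cJ] := @min_join_le _ _ ends [ffun=> true] (fun=> 1%N) 4 (fun e => c e + K)%N.
- move=> U; rewrite oddT sum1_card => oU; apply: conn.
    by apply: contraTneq oU => ->; rewrite cards0.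
  by apply: contraTneq oU => ->; rewrite cardsT.
- by apply: join_exists; rewrite oddT cardsT; apply/negbTE.
pose M := [set e | J e]; pose deg v := #|[set e in M | incident ends v e]|.
have degE v : (\sum_(e | incident ends v e) J e = deg v)%N.
  rewrite /deg -sum1_card big_mkcond [RHS]big_mkcond; apply: eq_bigr => e _.
  by rewrite !inE andbC; case: incident; case: (J e).
have deg_gt0 v : (0 < deg v)%N.
  by have := boundary_incident J v; rewrite bJ ffunE degE; case: (deg v).
have EV : (#|E| = 2 * #|V|)%N.
  have := card_delta setT; rewrite deltaT cards0 addn0 cardsT.
  rewrite (_ : [set e | _] = setT) ?cardsT; first by lia.
  by apply/setP => e; rewrite !inE.
have sumdeg : (\sum_v deg v = 2 * #|M|)%N.
  have := sum_incident_nat (fun e => J e : nat) setT; rewrite deltaT big_set0 addn0.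
  under eq_bigl do rewrite inE; under eq_bigr do rewrite degE.
  move=> ->; congr (2 * _)%N; rewrite -sum1_card big_mkcond [in RHS]big_mkcond.
  by apply: eq_bigr => e _; rewrite !inE /=; case: (J e).
have costM : (cost (fun e => c e + K) J = \sum_(e in M) c e + #|M| * K)%N.
  rewrite -sum_nat_const -big_split; apply: eq_bigl => e.
  by rewrite inE.
have degM : (2 * #|M| = #|V|)%N.
  apply/eqP; rewrite eqn_leq; apply/andP; split; last first.
    by rewrite -sumdeg -sum1_card; apply: leq_sum => v _; apply: deg_gt0.
  rewrite leqNgt; apply/negP => big.
  move: cJ; rewrite costM; under [leqRHS]eq_bigr do rewrite mul1n.
  rewrite big_split /= sum_nat_const EV; have := leq_mul big (leqnn (2 * K)).
  by rewrite /K; lia.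
have deg1 v : deg v = 1%N.
  apply/eqP; rewrite eqn_leq deg_gt0 andbT leqNgt; apply/negP => big.
  have : (\sum_(u | u != v) 1 <= \sum_(u | u != v) deg u)%N by apply: leq_sum => u _; apply: deg_gt0.
  have -> : (\sum_(u | u != v) 1 = #|V|.-1)%N.
    by rewrite sum1dep_card -(cardsC1 v); apply: eq_card => u; rewrite !inE.
  move: sumdeg; rewrite degM (bigD1 v) //=.
  by move: (deg v) big (\sum_(u | _) _)%N #|V| => x big y N; lia.
have /fin_all_exists[m mP] v : exists e, [set e in M | incident ends v e] = [set e].
  by apply/cards1P; rewrite -/(deg v) deg1.
exists M, m; split=> [v e|]; first by have /setP/(_ e) := mP v; rewrite in_set1 inE.
move: cJ; rewrite costM; under [leqRHS]eq_bigr do rewrite mul1n.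
by rewrite big_split /= sum_nat_const EV; have := degM; nia.
Qed.

(** * Spanning tree and parity correction for a fixed perfect matching *)

Section Matching.
Hypothesis no4 : no_proper_4_edge_cut ends.
Hypothesis V4 : (3 < #|V|)%N.
Variables (M : {set E}) (m : V -> E).
Hypothesis mP : forall v e, (e \in M) && incident ends v e = (e == m v).

Lemma mate_in v : m v \in M.
Proof. by have := mP v (m v); rewrite eqxx => /andP[]. Qed.

Lemma mate_incident v : incident ends v (m v).
Proof. by have := mP v (m v); rewrite eqxx => /andP[]. Qed.

Lemma mate_eq v e : e \in M -> incident ends v e -> m v = e.
Proof. by move=> eM ve; apply/esym/eqP; rewrite -mP eM. Qed.

Lemma mate_ends e : e \in M -> m (ends e).1 = e /\ m (ends e).2 = e.
Proof. by move=> eM; split; apply: mate_eq; rewrite // /incident eqxx ?orbT. Qed.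

(** The two vertices merged by contracting [e] when [e] is in [M]; empty for any other edge. *)
Let block e := [set v | m v == e].

Lemma card_block e : e \in M -> #|block e| = 2%N.
Proof.
move=> eM; have -> : block e = [set (ends e).1; (ends e).2].
  by apply/setP => v; rewrite !inE eq_sym -mP eM.
by rewrite cards2 no_loop.
Qed.

Lemma block_edges e : e \in M ->
  e \in [set g | ((ends g).1 \in block e) && ((ends g).2 \in block e)].
Proof. by move=> eM; have [e1 e2] := mate_ends eM; rewrite !inE e1 e2 eqxx. Qed.

Lemma card_delta_block e : (#|delta ends (block e)| <= 6)%N.
Proof.
have := card_delta (block e); case eM: (e \in M).
  have : (0 < #|[set g | ((ends g).1 \in block e) && ((ends g).2 \in block e)]|)%N.
    by apply/card_gt0P; exists e; apply: block_edges.
  by rewrite card_block //; lia.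
suff -> : block e = set0 by rewrite cards0; lia.
by apply/setP => v; rewrite !inE; apply: contraFF eM => /eqP <-; apply: mate_in.
Qed.

(** A second edge inside the block would leave at most 8 - 4 = 4 edges in its cut, which is proper
    since |V| > 3. *)
Lemma block_only_edge e g : e \in M -> m (ends g).1 = e -> m (ends g).2 = e -> g = e.
Proof.
move=> eM g1 g2; apply/eqP/negPn/negP => ge.
have := card_delta (block e); rewrite card_block //.
have : proper_cut (block e).
  by rewrite /proper_cut card_block //; have := cardsC (block e); rewrite card_block //; lia.
move/(proper_cut_ge6 no4).
have : (1 < #|[set g | ((ends g).1 \in block e) && ((ends g).2 \in block e)]|)%N.
  by apply/card_gt1P; exists g, e; rewrite block_edges // !inE g1 g2 eqxx.
by lia.
Qed.

(* Contracting M leaves a graph of maximum degree 6, so M splits into seven classes of edges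
   at pairwise distance at least two. *)
Lemma sparse_submatching (c : E -> nat) : exists S : {set E},
  [/\ S \subset M, (\sum_(e in M) c e <= 7 * \sum_(e in S) c e)%N,
      forall g, m (ends g).1 \in S -> m (ends g).2 \in S -> g \in S & exists e, e \in M :\: S].
Proof.
pose adj e e' := [exists g, (m (ends g).1 == e) && (m (ends g).2 == e') ||
                            (m (ends g).1 == e') && (m (ends g).2 == e)].
have adjC : symmetric adj by move=> e e'; apply: eq_existsb => g; rewrite orbC.
have [e|col colP] := @greedy_coloring E adj 6 adjC.
  apply: leq_trans (card_delta_block e).
  (* Each neighbour of [e] is reached through an edge leaving the block, so there are at most
     six. *)
  pose h g := if m (ends g).1 == e then m (ends g).2 else m (ends g).1.
  apply: leq_trans (leq_imset_card h _); apply: subset_leq_card; apply/subsetP => e'.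
  rewrite inE => /andP[ne /existsP[g gP]]; apply/imsetP; exists g.
    rewrite in_delta !inE; case/orP: gP => /andP[/eqP-> /eqP->]; rewrite eqxx ?(negPf ne) //.
  by rewrite /h; case/orP: gP => /andP[/eqP-> /eqP->]; rewrite ?eqxx // (negPf ne).
pose S i := [set e in M | col e == i].
(* The costliest of the seven colour classes. *)
have [i _ imax] := @arg_maxnP _ ord0 predT (fun i => \sum_(e in S i) c e)%N isT.
have S_edge g : m (ends g).1 \in S i -> m (ends g).2 \in S i -> g \in S i.
  move=> g1S g2S; have [g12|g12] := eqVneq (m (ends g).1) (m (ends g).2).
    by rewrite (@block_only_edge (m (ends g).1) g) // mate_in.
  have /(colP _ _ g12) : adj (m (ends g).1) (m (ends g).2) by apply/existsP; exists g; rewrite !eqxx.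
  by move: g1S g2S; rewrite !inE => /andP[_ /eqP->] /andP[_ /eqP->]; rewrite eqxx.
exists (S i); split=> //.
- by apply/subsetP => e; rewrite inE => /andP[].
- rewrite (partition_big col predT) //= -[X in (_ <= X * _)%N]card_ord -sum_nat_const.
  apply: leq_sum => j _; apply: leq_trans (imax j isT); rewrite leq_eqVlt; apply/orP; left.
  by apply/eqP/eq_bigl => e; rewrite inE.
have /card_gt0P[v _] : (0 < #|V|)%N by lia.
(* If the class were all of [M], then [S_edge] would put every edge in [M], yet an edge leaving a
   block is not in [M]. *)
have [/eqP MS|/set0Pn//] := eqVneq (M :\: S i) set0.
rewrite setD_eq0 in MS; have MS' e : e \in M -> e \in S i by apply: (subsetP MS).
pose U := block (m v).
have cU : #|U| = 2%N by rewrite card_block // mate_in.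
have /card_gt0P[g] : (0 < #|delta ends U|)%N.
  apply: leq_trans (conn (U := U) _ _) => //.
    by apply: contra_eq_neq cU => ->; rewrite cards0.
  by apply: contra_eq_neq cU => ->; rewrite cardsT; lia.
have : g \in M.
  by have := S_edge g (MS' _ (mate_in _)) (MS' _ (mate_in _)); rewrite inE => /andP[].
by move/mate_ends => [g1 g2]; rewrite in_delta !inE g1 g2 eqxx.
Qed.

Lemma card_incident_mate v : #|[pred e | incident ends v e && (e != m v)]| = 3%N.
Proof.
have := reg v; rewrite (cardsD1 (m v)) inE mate_incident => -[<-].
by apply: eq_card => e; rewrite !inE andbC.
Qed.

Lemma notin_matching v e : incident ends v e -> e != m v -> e \notin M.
Proof. by move=> ve; apply: contraNN => eM; rewrite eq_sym; apply/eqP/mate_eq. Qed.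

Section Tree.
Variables (S : {set E}) (e0 : E).
Hypothesis SM : S \subset M.
Hypothesis S_edge : forall g, m (ends g).1 \in S -> m (ends g).2 \in S -> g \in S.
Hypothesis e0MS : e0 \in M :\: S.

(* One matching edge outside S gets weight 0, which lowers the total to the size of a
   spanning tree without touching the stars at the ends of S. *)
Let z0 (e : E) : rat := if e \in M then 1 else 1 / 3.
Let z (e : E) : rat := z0 e - (e == e0)%:R.

Lemma z0_others v : \sum_(e | incident ends v e && (e != m v)) z0 e = 1.
Proof.
rewrite (eq_bigr (fun=> 1 / 3)) => [|e /andP[ve em]].
  by rewrite sumr_const card_incident_mate; lra.
by rewrite /z0 (negPf (notin_matching ve em)).
Qed.

Lemma z0_degree v : \sum_(e | incident ends v e) z0 e = 2.
Proof.
rewrite (bigD1 (m v)) ?mate_incident //= z0_others /z0 mate_in; lra.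
Qed.

Lemma z0_total : \sum_e z0 e = #|V|%:R.
Proof.
have := sum_incident_rat z0 setT; under eq_bigr do rewrite z0_degree.
rewrite deltaT big_set0 addr0 sumr_const cardsT -mulr_natr.
under eq_bigl do rewrite !inE; lra.
Qed.

Lemma z_total : \sum_e z e = #|V|%:R - 1.
Proof.
rewrite sumrB z0_total (bigD1 e0) //= eqxx big1 ?addr0 // => e /negPf->.
by [].
Qed.

Lemma z_ge0 e : 0 <= z e.
Proof.
rewrite /z /z0; case: eqP => [->|_]; first by case/setDP: e0MS => -> _; rewrite subrr.
by rewrite subr0; case: ifP => _; lra.
Qed.

(** By the handshake it suffices that [z0] is at least 2 on the cut: stars have exactly 2, other
    cuts at least six edges of weight at least 1/3. Only U = V uses the reduction at [e0]. *)
Lemma z_forest U : U != set0 ->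
  \sum_(e | ((ends e).1 \in U) && ((ends e).2 \in U)) z e <= #|U|%:R - 1.
Proof.
move=> U0; have [->|UT] := eqVneq U setT.
  by rewrite cardsT -z_total; under eq_bigl do rewrite !inE.
have le_z : \sum_(e | ((ends e).1 \in U) && ((ends e).2 \in U)) z e <=
            \sum_(e | ((ends e).1 \in U) && ((ends e).2 \in U)) z0 e.
  by apply: ler_sum => e _; rewrite /z lerBlDr lerDl ler0n.
apply: le_trans le_z _.
have := sum_incident_rat z0 U; under eq_bigr do rewrite z0_degree.
rewrite sumr_const -mulr_natr.
suff : 2 <= \sum_(e in delta ends U) z0 e by lra.
have one (X : {set V}) : #|X| = 1%N -> \sum_(e in delta ends X) z0 e = 2.
  move=> /eqP/cards1P[v ->]; rewrite -(z0_degree v).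
  by apply: eq_bigl => e; rewrite delta1.
have [U1|U1] := eqVneq #|U| 1%N; first by rewrite one.
have [UC1|UC1] := eqVneq #|~: U| 1%N; first by rewrite -deltaC one.
have U6 : (6 <= #|delta ends U|)%N.
  apply: proper_cut_ge6 => //; rewrite /proper_cut.
  have UC0 : #|~: U| != 0%N.
    by rewrite cards_eq0; apply: contraNneq UT => C0; rewrite -[U]setCK C0 setC0.
  by move: U0; rewrite -cards_eq0; lia.
apply: (@le_trans _ _ (\sum_(e in delta ends U) (1 / 3))).
  by rewrite sumr_const -mulr_natr; move: U6; rewrite -(ler_nat rat); lra.
by apply: ler_sum => e _; rewrite /z0; case: (e \in M); lra.
Qed.

(** Each edge of [S] is a class of its own, and so are the three other edges at each end of [S];
    [None] collects the rest. By [S_edge] no edge falls into the classes of two different ends. *)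
Let label (e : E) : option (E + V) :=
  if e \in S then Some (inl e) else if m (ends e).1 \in S then Some (inr (ends e).1)
  else if m (ends e).2 \in S then Some (inr (ends e).2) else None.

Lemma labelE e : e \in S -> forall g, (label g == Some (inl e)) = (g == e).
Proof.
move=> eS g; rewrite /label; case: ifP => gS; first by [].
by case: ifP => _; [|case: ifP => _]; apply/esym/negP => /eqP ge; rewrite ge eS in gS.
Qed.

Lemma labelV v : m v \in S ->
  forall g, (label g == Some (inr v)) = incident ends v g && (g != m v).
Proof.
move=> vS g; rewrite /label; case: ifP => gS.
  apply/esym/negP => /andP[vg /negP]; apply.
  by apply/eqP/esym/mate_eq; rewrite // (subsetP SM).
have gm : g != m v by apply: contraFneq gS => ->.
rewrite gm andbT /incident; case: ifP => g1; last case: ifP => g2.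
- rewrite -[_ == _]/((ends g).1 == v) eq_sym; case: eqVneq => //= _.
  by apply/esym/negP => /eqP v2; rewrite S_edge -?v2 // in gS.
- rewrite -[_ == _]/((ends g).2 == v) eq_sym; case: (eqVneq v (ends g).1) => //= v1.
  by rewrite v1 g1 in vS.
by apply/esym/negP => /orP[] /eqP v'; rewrite v' ?g1 ?g2 in vS.
Qed.

Lemma z_label_inl e : e \in S -> \sum_(g | label g == Some (inl e)) z g = 1.
Proof.
move=> eS; rewrite (eq_bigl _ _ (labelE eS)) big_pred1_eq /z /z0 (subsetP SM) //.
case: eqP => [ee|_]; last by rewrite subr0.
by case/setDP: e0MS; rewrite -ee eS.
Qed.

Lemma z_label_inr v : m v \in S -> \sum_(g | label g == Some (inr v)) z g = 1.
Proof.
move=> vS; rewrite (eq_bigl _ _ (labelV vS)) -(z0_others v); apply: eq_bigr => e /andP[ve em].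
rewrite /z; case: eqP => [ee|_]; last by rewrite subr0.
by case/setDP: e0MS => + _; rewrite -ee (negPf (notin_matching ve em)).
Qed.

Lemma z_label_some (a : E + V) : \sum_(g | label g == Some a) z g \is a Num.int.
Proof.
case: a => [e|v].
  have [eS|eS] := boolP (e \in S); first by rewrite z_label_inl // rpred1.
  rewrite big_pred0 ?rpred0 // => g; rewrite /label; case: ifP => [gS|_].
    by apply/negP => /eqP[ge]; rewrite -ge gS in eS.
  by do 2?case: ifP => _.
have [vS|vS] := boolP (m v \in S); first by rewrite z_label_inr // rpred1.
rewrite big_pred0 ?rpred0 // => g; rewrite /label; case: ifP => // _.
case: ifP => [gS|_]; first by apply/negP => /eqP[gv]; rewrite -gv gS in vS.
by case: ifP => // gS; apply/negP => /eqP[gv]; rewrite -gv gS in vS.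
Qed.

Lemma z_label_int l : \sum_(g | label g == l) z g \is a Num.int.
Proof.
case: l => [a|]; first exact: z_label_some.
(* The class [None] is what the other classes leave of the integral total |V| - 1. *)
have := z_total; rewrite (partition_big label predT) //= (bigD1 None) //= => /(canRL (addrK _)) ->.
rewrite rpredB ?rpredB ?rpred_nat ?rpred1 // rpred_sum // => -[a|] // _.
exact: z_label_some.
Qed.

(** The classes at [S] have weight 1, so the tree contains [S] and one further edge at each of its
    ends. The factor 3 clears the weight 1/3, and restoring the weight of [e0] can only weaken the
    bound. *)
Lemma matching_tree (c : E -> nat) : exists F : {set E},
  [/\ forall U, delta ends U != set0 -> exists2 e, e \in delta ends U & e \in F,
      forall v, m v \in S -> (\sum_(e | incident ends v e) (e \in F) = 2)%N &
      (3 * \sum_(e in F) c e <= 3 * (\sum_(e in M) c e) + \sum_(e in ~: M) c e)%N].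
Proof.
have V0 : (0 < #|V|)%N by lia.
have [F [FU Fl Fc]] := label_spanning_tree c V0 z_ge0 z_forest z_total z_label_int.
exists F; split=> // [v vS|].
  have mF : m v \in F.
    have := Fl (Some (inl (m v))); rewrite z_label_inl // -[1]/(1%:R) => /eqP; rewrite eqr_nat.
    move/eqP=> c1; have /card_gt0P[e] : (0 < #|[set e in F | label e == Some (inl (m v))]|)%N by rewrite c1.
    by rewrite inE labelE // => /andP[eF /eqP <-].
  rewrite (bigD1 (m v)) ?mate_incident //= mF; congr addn.
  have := Fl (Some (inr v)); rewrite z_label_inr // -[1]/(1%:R) => /eqP; rewrite eqr_nat => /eqP <-.
  rewrite -sum1_card big_mkcond [RHS]big_mkcond; apply: eq_bigr => e _.
  by rewrite inE labelV // andbC; case: (e \in F); case: ifP.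
rewrite -(ler_nat rat) natrD !natrM !natr_sum.
apply: (@le_trans _ _ (3 * \sum_e (c e)%:R * z0 e)).
  rewrite ler_pM2l //; apply: le_trans Fc _; apply: ler_sum => e _.
  by rewrite ler_wpM2l ?ler0n // /z lerBlDr lerDl ler0n.
rewrite mulr_sumr mulr_sumr [X in X + _]big_mkcond [X in _ + X]big_mkcond -big_split /=.
apply: ler_sum => e _; rewrite in_setC /z0; case: (e \in M) => /=; lra.
Qed.

End Tree.

(** The tour is the tree plus a cheap join of its odd vertices; as both are edge sets,
    multiplicities stay at most 2. *)
Lemma matching_tour (c : E -> nat) : (4 * \sum_(e in M) c e <= \sum_e c e)%N ->
  exists t : {ffun E -> nat}, [/\ is_tour ends t, forall e, (t e <= 2)%N &
    (42 * \sum_e c e * t e <= 31 * \sum_e c e)%N].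
Proof.
move=> cM; have [S [SM cS S_edge [e0 e0MS]]] := sparse_submatching c.
have [F [FU F2 Fc]] := matching_tree SM S_edge e0MS c.
pose FF : {ffun E -> bool} := [ffun e => e \in F].
(* Divided by 6, [w] is the fractional correction: 1/2 on [M :\: S] and 1/6 elsewhere. *)
pose T := boundary ends FF; pose w e := (if e \in M :\: S then 3 else 1)%N.
have w1 e : (1 <= w e)%N by rewrite /w; case: ifP.
have TS v : m v \in S -> T v = false.
  move=> vS; rewrite /T boundary_incident; under eq_bigr do rewrite ffunE.
  by rewrite F2.
have oddTT : odd_in T setT = false.
  by rewrite /odd_in sum_boundary_in deltaT eq_card0 // => e; rewrite !inE.
have oddTC U : odd_in T (~: U) = odd_in T U.
  have : odd_in T setT = odd_in T U + odd_in T (~: U).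
    rewrite !odd_in_sum -big_split; apply: eq_bigr => v _; rewrite !inE.
    by case: (v \in U); case: (T v).
  by rewrite oddTT; case: (odd_in T U); case: (odd_in T (~: U)).
(* An odd vertex is not an end of [S], so its star weighs 3 + 3 = 6. *)
have star U : #|U| = 1%N -> odd_in T U -> (6 <= \sum_(e in delta ends U) w e)%N.
  move=> /eqP/cards1P[v ->]; rewrite /odd_in big_set1 => Tv.
  rewrite (eq_bigl (incident ends v)) => [|e]; last exact: delta1.
  have vS : m v \notin S by apply: contraTN Tv => /TS->.
  rewrite (bigD1 (m v)) ?mate_incident //= {1}/w in_setD vS mate_in /= (@leq_add 3 3) //.
  rewrite -(card_incident_mate v) -sum1_card big_mkcond [leqRHS]big_mkcond.
  by apply: leq_sum => e _; rewrite inE; case: ifP.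
have cuts U : odd_in T U -> (6 <= \sum_(e in delta ends U) w e)%N.
  move=> oU; have [U1|U1] := eqVneq #|U| 1%N; first exact: star.
  have [UC1|UC1] := eqVneq #|~: U| 1%N; first by rewrite -deltaC star // oddTC.
  apply: (@leq_trans #|delta ends U|); last by rewrite -sum1_card; apply: leq_sum.
  have odd0 (X : {set V}) : odd_in T X -> #|X| != 0%N.
    by rewrite cards_eq0; apply: contraTneq => ->; rewrite /odd_in big_set0.
  apply: proper_cut_ge6 => //; rewrite /proper_cut.
  by have := odd0 U oU; have := odd0 (~: U); rewrite oddTC oU => /(_ isT); lia.
have [J bJ cJ] := min_join_le c cuts (ex_intro _ FF erefl).
exists [ffun e => (e \in F) + J e]%N; split.
- split.
    by apply: support_connected => U /FU[e eU eF]; exists e; rewrite // ffunE eF.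
  move=> v; rewrite /mult_deg; under eq_bigr do rewrite ffunE.
  rewrite big_split oddD /= -boundary_incident bJ.
  have -> : T v = odd (\sum_(e | incident ends v e) (e \in F)).
    by rewrite /T boundary_incident; under eq_bigr do rewrite ffunE.
  by rewrite addbb.
- by move=> e; rewrite ffunE; case: (e \in F); case: (J e).
have split_t : (\sum_e c e * [ffun e => (e \in F) + J e] e = \sum_(e in F) c e + cost c J)%N.
  rewrite /cost [X in (X + _)%N]big_mkcond [X in (_ + X)%N]big_mkcond -big_split.
  apply: eq_bigr => e _; rewrite ffunE mulnDr.
  by case: (e \in F); case: (J e); rewrite ?muln1 ?muln0.
have wc : (\sum_e w e * c e + 2 * \sum_(e in S) c e = \sum_e c e + 2 * \sum_(e in M) c e)%N.
  rewrite !big_distrr /= [X in (_ + X = _)%N]big_mkcond [X in (_ = _ + X)%N]big_mkcond -!big_split.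
  apply: eq_bigr => e _; rewrite /w in_setD; have := subsetP SM e.
  by case: (e \in S) => [/(_ isT)->|_]; case: (e \in M) => /=; lia.
have MC : (\sum_e c e = \sum_(e in M) c e + \sum_(e in ~: M) c e)%N.
  by rewrite (bigID (mem M)) /=; congr addn; apply: eq_bigl => e; rewrite inE.
(* 14 times [Fc] plus 7 times [cJ] bounds 42 times the cost by 21 c(E) + 42 c(M) - 14 c(S). This is
   at most 21 c(E) + 40 c(M) by [cS], and at most 31 c(E) by [cM]. *)
rewrite split_t; lia.
Qed.

End Matching.
End Cuts.
End Graph.

(** * Cheap tours for every vertex count, and the convex combination *)

Section CheapTours.
Variables (V E : finType) (ends : E -> V * V).
Hypothesis no_loop : loopless ends.
Hypothesis reg : k_regular ends 4.
Hypothesis conn : k_edge_connected ends 4.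

(** [matching_tour] requires more than three vertices. Here the graph is four parallel edges, and
    doubling the cheapest one costs at most half of the total. *)
Lemma two_vertex_tour (c : E -> nat) : #|V| = 2%N ->
  exists t : {ffun E -> nat}, [/\ is_tour ends t, forall e, (t e <= 2)%N &
    (42 * \sum_e c e * t e <= 31 * \sum_e c e)%N].
Proof.
move=> V2; have E4 : #|E| = 4%N.
  have := card_delta no_loop reg setT; rewrite deltaT cards0 cardsT V2.
  rewrite (_ : [set e | _] = setT) ?cardsT; first by lia.
  by apply/setP => e; rewrite !inE.
have /card_gt0P[e0 _] : (0 < #|E|)%N by rewrite E4.
have [e _ emin] := @arg_minnP _ e0 predT c isT.
have endsT : [set (ends e).1; (ends e).2] = setT.
  by apply/eqP; rewrite eqEcard subsetT cardsT V2 cards2 no_loop.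
exists [ffun f => if f == e then 2 else 0]%N; split.
- split=> [|v].
    apply: (support_connected conn) => U dU; exists e; last by rewrite ffunE eqxx.
    have UE v : (v \in U) = if v == (ends e).1 then (ends e).1 \in U else (ends e).2 \in U.
      case: eqP => [->//|/eqP v1]; have := in_setT v; rewrite -endsT !inE (negPf v1) /=.
      by move/eqP->.
    rewrite in_delta; apply: contra dU => /eqP e12; apply/eqP/setP => f.
    by rewrite in_delta !(UE (ends f).1) !(UE (ends f).2) e12 !if_same eqxx inE.
  apply: (big_ind (fun k => ~~ odd k)) => // [k l /negPf k0 /negPf l0|f _].
    by rewrite oddD k0 l0.
  by rewrite ffunE; case: ifP.
- by move=> f; rewrite ffunE; case: ifP.
rewrite (bigD1 e) //= ffunE eqxx big1 ?addn0 => [|f /negPf fe]; last by rewrite ffunE fe muln0.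
have : (\sum_(f : E) c e <= \sum_f c f)%N by apply: leq_sum => f _; apply: emin.
by rewrite sum_nat_const E4; lia.
Qed.

Theorem cheap_tour (c : E -> nat) : ~~ odd #|V| -> no_proper_4_edge_cut ends ->
  exists t : {ffun E -> nat}, [/\ is_tour ends t, forall e, (t e <= 2)%N &
    (42 * \sum_e c e * t e <= 31 * \sum_e c e)%N].
Proof.
move=> evenV no4; have [V4|] := ltnP 3 #|V|.
  have [M [m [mP cM]]] := perfect_matching_le no_loop reg conn c evenV.
  exact: (matching_tour no_loop reg conn no4 V4 mP cM).
have [V0|V0] := posnP #|V|.
  exists [ffun=> 0%N]; split=> [|e|]; last 2 first.
  - by rewrite ffunE.
  - by rewrite big1 // => e _; rewrite ffunE muln0.
  by split=> x; have := card0_eq V0 x; rewrite inE.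
by move: evenV V0; case EV: #|V| => [|[|[|[|//]]]] // _ _ _; apply: two_vertex_tour.
Qed.

End CheapTours.

Theorem mainTheorem4 (R : realFieldType) (V E : finType) (ends : E -> V * V) :
  loopless ends ->
  k_regular ends 4 ->
  k_edge_connected ends 4 ->
  ~~ odd #|V| ->
  no_proper_4_edge_cut ends ->
  exists (n : nat) (lam : 'I_n -> R) (T : 'I_n -> {ffun E -> nat}),
    [/\ forall i, 0 <= lam i,
        \sum_(i < n) lam i = 1,
        forall i, is_tour ends (T i)
      & forall e : E,
          \sum_(i < n) lam i * ((T i e)%:R) <= (3 / 2 - 1 / 42) * (1 / 2)].
Proof.
move=> no_loop reg conn evenV no4.
(* The tours from [cheap_tour] have multiplicities at most 2, so they can be indexed by a finite
   type. *)
pose mult (t : {ffun E -> 'I_3}) : {ffun E -> nat} := [ffun e => t e : nat].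
pose tourb t := [forall x, forall y, connect (mult_adj ends (mult t)) x y] &&
                [forall v, ~~ odd (mult_deg ends (mult t) v)].
pose I : finType := {t : {ffun E -> 'I_3} | tourb t}.
(* 31/42 is (3/2 - 1/42)/2. The combination is found over [rat] and carried to [R] by [ratr]. *)
have [|l [l0 l1 lT]] := @dominates_convex_comb I E (fun i e => (mult (val i) e)%:R) (fun=> 31 / 42).
  move=> c; have [t [[tconn teven] t2 tc]] := cheap_tour no_loop reg conn c evenV no4.
  pose t3 : {ffun E -> 'I_3} := [ffun e => inord (t e)].
  have mt3 : mult t3 = t by apply/ffunP => e; rewrite !ffunE inordK // ltnS.
  have tb : tourb t3.
    by rewrite /tourb mt3; apply/andP; split; apply/forallP => x //; apply/forallP => y.
  exists (Sub t3 tb); rewrite SubK mt3 -mulr_suml -(ler_pM2l (_ : 0 < 42)) //.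
  move: tc; rewrite -(ler_nat rat) !natrM !natr_sum.
  under eq_bigr do rewrite natrM.
  by lra.
exists #|I|, (fun i => ratr (l (enum_val i))), (fun i => mult (val (enum_val i))); split.
- by move=> i; rewrite ler0q.
- by rewrite -(big_enum_val (fun i => ratr (l i))) -rmorph_sum l1 rmorph1.
- move=> i; have /andP[/forallP h /forallP h'] := valP (enum_val i).
  by split=> // x y; apply/forallP: y.
move=> e; rewrite -(big_enum_val (fun i : I => ratr (l i) * (mult (val i) e)%:R)).
have := lT e; rewrite -(ler_rat R) rmorph_sum fmorph_div /= !ratr_nat => h.
under eq_bigr do rewrite -(ratr_nat R) -rmorphM.
by lra.
Qed.
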